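(* Let $X,Y$ be infinite dimensional Hilbert spaces and $T:X\to Y$ a bounded, linear, injective operator whose range $\mathcal{R}(T)$ is not closed. Let $\{g_\alpha\}_{\alpha\in(0,\alpha_0)}$ be a spectral regularization method, $R_\alpha=g_\alpha(T^\ast T)T^\ast$, $\rho\in\mathcal{O}$, $s\in\mathcal{S}$, $y\in\mathcal{D}(T^\dagger)$ and $x^\dagger=T^\dagger y$. If $(\rho,s)$ is an order-source pair for $\{g_\alpha\}$ and $\|(R_\alpha-T^\dagger)y\|=O(\rho(\alpha))$ as $\alpha\to0^+$, then $x^\dagger\in\mathcal{R}(s(T^\ast T))$.
   Context: $T^\dagger$ is the Moore–Penrose generalized inverse of $T$, with domain $\mathcal{D}(T^\dagger)=\mathcal{R}(T)\oplus\mathcal{R}(T)^\perp$. Functions of $T^\ast T$ are defined by the spectral functional calculus of the self-adjoint operator $T^\ast T$, and $\mathcal{R}(\cdot)$ denotes the range. Let $\alpha_0\in(0,+\infty]$. A spectral regularization method (SRM) is a family $\{g_\alpha\}_{\alpha\in(0,\alpha_0)}$ of functions $g_\alpha:[0,+\infty)\to\mathbb{R}$ such that: for each $\alpha$, $g_\alpha(\lambda)$ is piecewise continuous in $\lambda\in[0,+\infty)$; there is a constant $C>0$, independent of $\alpha$, with $|\lambda g_\alpha(\lambda)|\le C$ for every $\lambda\in[0,+\infty)$; and $\lim_{\alpha\to0^+}g_\alpha(\lambda)=1/\lambda$ for every $\lambda\in(0,+\infty)$. Put $r_\alpha(\lambda)=1-\lambda g_\alpha(\lambda)$. $\mathcal{O}$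 is the set of all non-decreasing functions $\rho:\mathbb{R}^+\to\mathbb{R}^+$ with $\lim_{\alpha\to0^+}\rho(\alpha)=0$. $\mathcal{S}$ is the set of all continuous $s:[0,+\infty)\to[0,+\infty)$ with $s(0)=0$ and $s(\lambda)>0$ for every $\lambda>0$. $(\rho,s)$ is an order-source pair for $\{g_\alpha\}$ if there exist $\gamma>0$ and $h:(0,\alpha_0)\to\mathbb{R}^+$ with $\lim_{\alpha\to0^+}h(\alpha)=0$ such that $\frac{s(\lambda)|r_\alpha(\lambda)|}{\rho(\alpha)}\ge\gamma$ for all $\lambda\in[h(\alpha),+\infty)$ and all $\alpha\in(0,\alpha_0)$. *)

(* Defs.v *)
From HB Require Import structures.
From mathcomp Require Import all_boot all_order all_algebra.
From mathcomp Require Import sesquilinear complex.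
From mathcomp Require Import all_classical all_reals all_analysis.

Set Implicit Arguments.
Unset Strict Implicit.
Unset Printing Implicit Defensive.

Import Order.TTheory GRing.Theory Num.Theory.
Import HBSimple.
Import numFieldTopology.Exports numFieldNormedType.Exports.

Local Open Scope classical_set_scope.
Local Open Scope ring_scope.

(* Hilbert spaces are over the real or over the complex numbers; the scalar
   field is selected by a flag so that both cases share all definitions. *)
Variant scalar_kind := RealScalars | ComplexScalars.

Definition scalars (R : realType) (k : scalar_kind) : numFieldType :=
  match k with RealScalars => R | ComplexScalars => R[i]%C end.

Definition scalar_conj (R : realType) (k : scalar_kind) :
    scalars R k -> scalars R k :=
  match k with RealScalars => idfun | ComplexScalars => @conjc R end.

Definition scalar_re (R : realType) (k : scalar_kind) : scalars R k -> R :=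
  match k with RealScalars => idfun | ComplexScalars => @complex.Re R end.

Definition of_real (R : realType) (k : scalar_kind) : R -> scalars R k :=
  match k with RealScalars => idfun | ComplexScalars => real_complex R end.

(* [inner] is linear in its first and conjugate-linear in its second
   argument; the norm (hence the topology, which is complete) is the one it
   induces. *)
HB.mixin Record isHilbert (R : realType) (k : scalar_kind) (H : Type)
    of CompleteNormedModule (scalars R k) H := {
  inner : {dot H for @scalar_conj R k} ;
  inner_norm : forall x : H, inner x x = `|x| ^+ 2
}.

#[short(type="hilbertType")]
HB.structure Definition Hilbert (R : realType) (k : scalar_kind) :=
  { H of CompleteNormedModule (scalars R k) H & isHilbert R k H }.

Section operators.
Context {R : realType} {k : scalar_kind}.
Implicit Types X Y H : hilbertType R k.

(* The library norm of a normed module takes its values in the scalar field;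
   this is the same number as an element of R. *)
Definition hnorm H (x : H) : R := scalar_re `|x|.

Definition infinite_dimensional H : Prop :=
  ~ exists (n : nat) (e : 'I_n -> H),
      forall x, exists c : 'I_n -> scalars R k, x = \sum_(i < n) c i *: e i.

Definition bounded_operator X Y (T : X -> Y) : Prop :=
  exists M : R, forall x, hnorm (T x) <= M * hnorm x.

Definition orth H (S : set H) : set H :=
  [set x | forall z, S z -> inner z x = 0].

(* The element chosen by [get] exists, by the Riesz representation theorem,
   and is unique when T is a bounded operator. *)
Definition adjoint X Y (T : {linear X -> Y}) (y : Y) : X :=
  get [set x : X | forall u, inner (T u) y = inner u x].

Definition mp_domain X Y (T : {linear X -> Y}) : set Y :=
  [set y | exists z w, [/\ range T z, orth (range T) w & y = z + w]].

(* Moore-Penrose inverse: the linear extension to R(T) (+) R(T)^perp of the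
   inverse of T : N(T)^perp -> R(T) which vanishes on R(T)^perp. *)
Definition mp_inverse X Y (T : {linear X -> Y}) (y : Y) : X :=
  get [set x : X | orth [set u | T u = 0] x /\
                   exists2 w, orth (range T) w & y = T x + w].

Definition projection_valued_measure H (E : set R -> H -> H) : Prop :=
  [/\ (forall B, measurable B ->
         [/\ linear (E B),
             (forall x, E B (E B x) = E B x) &
             (forall x y, inner (E B x) y = inner x (E B y))]),
      (forall x, E setT x = x) &
      (forall (F : (set R)^nat) x,
         (forall i, measurable (F i)) -> trivIset setT F ->
         (fun n => \sum_(i < n) E (F i) x) @ \oo --> E (\bigcup_i F i) x)].

(* B |-> <E(B)x, x> *)
Definition spectral_mass H (E : set R -> H -> H) (x : H) (B : set R) : \bar R :=
  ((hnorm (E B x)) ^+ 2)%:E.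

Definition simple_spectral_integral H (E : set R -> H -> H)
    (phi : {sfun R >-> R}) (x : H) : H :=
  \sum_(c \in range phi) (of_real k c *: E (phi @^-1` [set c]) x).

(* u = \int f dE x. By the isometry |\int phi dE x|^2 = \int phi^2 d<Ex, x>
   for simple phi, such a u exists exactly when the Borel function f is
   square-integrable for <Ex, x>, and then it does not depend on the
   approximating sequence. *)
Definition is_spectral_integral H (E : set R -> H -> H) (f : R -> R)
    (x u : H) : Prop :=
  measurable_fun setT f /\
  exists phi : nat -> {sfun R >-> R},
    (fun n => (\int[spectral_mass E x]_t ((f t - phi n t) ^+ 2)%:E)%E)
      @ \oo --> 0%E /\
    (fun n => simple_spectral_integral E (phi n) x) @ \oo --> u.

(* E is the spectral measure of A, that is A = \int t dE(t). *)
Definition spectral_measure_of H (A : H -> H) (E : set R -> H -> H) : Prop :=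
  projection_valued_measure E /\
  forall x, is_spectral_integral E id x (A x).

(* A function f on [0, +oo[ of the operator A >= 0 with spectral measure E is
   \int_[0, +oo[ f dE; f is a total function on R, whose values on the
   negative numbers are discarded. *)
Definition is_function_of_operator H (E : set R -> H -> H) (f : R -> R)
    (x u : H) : Prop :=
  is_spectral_integral E (f \_ `[0, +oo[) x u.

Definition function_of_operator H (E : set R -> H -> H) (f : R -> R)
    (x : H) : H :=
  get [set u : H | is_function_of_operator E f x u].

Definition range_function_of_operator H (E : set R -> H -> H)
    (f : R -> R) : set H :=
  [set u | exists x, is_function_of_operator E f x u].

End operators.

Section regularization.
Context {R : realType}.
Implicit Types (g : R -> R -> R) (rho s f : R -> R).

(* Piecewise continuity on [0, +oo[: finitely many discontinuities in every
   bounded interval, each with finite one-sided limits. *)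
Definition piecewise_continuous f : Prop :=
  [/\ (forall M : R,
         finite_set [set l | 0 < l <= M /\ ~ {for l, continuous f}]),
      (forall l, 0 <= l -> cvg (f @ l^'+)) &
      (forall l, 0 < l -> cvg (f @ l^'-))].

Definition spectral_regularization (a0 : \bar R) g : Prop :=
  [/\ (forall a, 0 < a -> (a%:E < a0)%E -> piecewise_continuous (g a)),
      (exists2 C : R, 0 < C &
         forall a l, 0 < a -> (a%:E < a0)%E -> 0 <= l -> `|l * g a l| <= C) &
      (forall l, 0 < l -> (fun a => g a l) @ 0^'+ --> l^-1)].

Definition residual g (a l : R) : R := 1 - l * g a l.

Definition order_function rho : Prop :=
  [/\ (forall a, 0 < a -> 0 < rho a),
      (forall a b, 0 < a -> a <= b -> rho a <= rho b) &
      rho @ 0^'+ --> 0].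

Definition source_function s : Prop :=
  [/\ {within `[0, +oo[, continuous s}, s 0 = 0 &
      (forall l, 0 < l -> 0 < s l)].

Definition order_source_pair (a0 : \bar R) g rho s : Prop :=
  exists (gamma : R) (h : R -> R),
    [/\ 0 < gamma,
        (forall a, 0 < a -> (a%:E < a0)%E -> 0 < h a),
        h @ 0^'+ --> 0 &
        (forall a l, 0 < a -> (a%:E < a0)%E -> h a <= l ->
           gamma <= s l * `|residual g a l| / rho a)].

End regularization.

(* Main.v *)
From HB Require Import structures.
Require Import Defs.
From mathcomp Require Import all_boot all_order all_algebra.
From mathcomp Require Import sesquilinear complex ring lra finmap.
From mathcomp Require Import all_classical all_reals all_analysis measurable_realfun.

(* Write x for the generalized solution and mu for the measure B |-> |E(B)x|^2.
   The normal equation gives g_a(T^*T) T^*y = g_a(T^*T) T^*T x, so the error is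
   -r_a(T^*T) x and its square is the integral of r_a^2 against mu.  On
   [h(a), +oo[ the order-source inequality reads gamma rho(a) / s <= |r_a|, so
   the rate O(rho) bounds the integral of s^-2 over [h(a), +oo[ uniformly in a.
   Since h(a) -> 0, monotone convergence puts 1/s in L^2(mu) on ]0, +oo[.
   Injectivity of T and positivity of T^*T concentrate E on ]0, +oo[, hence
   x = s(T^*T) x' with x' = int 1/s dE x.

   This uses the multiplicativity of the spectral integral, which follows from
   its isometry property and the identity d<E v, v> = f^2 d<E x, x> for
   v = int f dE x; the existence of T^* is the Riesz representation theorem. *)

Set Implicit Arguments.
Unset Strict Implicit.
Unset Printing Implicit Defensive.

Import Order.TTheory GRing.Theory Num.Theory.
Import HBSimple HBNNSimple.
Import numFieldTopology.Exports numFieldNormedType.Exports.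

Local Open Scope classical_set_scope.
Local Open Scope ring_scope.

(** * The real inner product of a Hilbert space *)

Section scalars.
Context {R : realType} {k : scalar_kind}.
Implicit Types (r : R) (z w : scalars R k).

Lemma scalar_reD z w : scalar_re (z + w) = scalar_re z + scalar_re w.
Proof. by case: k z w => //= -[a b] [c d]. Qed.

Lemma scalar_re_conj z : scalar_re (scalar_conj z) = scalar_re z.
Proof. by case: k z => //= -[a b]. Qed.

Lemma scalar_reZ r z : scalar_re (of_real k r * z) = r * scalar_re z.
Proof. by case: k z => //= -[a b]; rewrite /= mul0r subr0. Qed.

Lemma of_realK r : scalar_re (of_real k r) = r.
Proof. by case: k. Qed.

Lemma of_realD r1 r2 : of_real k (r1 + r2) = of_real k r1 + of_real k r2.
Proof. by case: k => //=; rewrite rmorphD. Qed.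

Lemma of_realB r1 r2 : of_real k (r1 - r2) = of_real k r1 - of_real k r2.
Proof. by case: k => //=; rewrite rmorphB. Qed.

Lemma of_realM r1 r2 : of_real k (r1 * r2) = of_real k r1 * of_real k r2.
Proof. by case: k => //=; rewrite rmorphM. Qed.

Lemma of_real0 : of_real k (0 : R) = 0.
Proof. by case: k => //=; rewrite rmorph0. Qed.

Lemma of_real1 : of_real k (1 : R) = 1.
Proof. by case: k => //=; rewrite rmorph1. Qed.

Lemma ler_of_real r1 r2 : (of_real k r1 <= of_real k r2) = (r1 <= r2).
Proof. by case: k => //=; rewrite lecR. Qed.

Lemma ltr_of_real r1 r2 : (of_real k r1 < of_real k r2) = (r1 < r2).
Proof. by case: k => //=; rewrite ltcR. Qed.

Lemma of_real_re z : 0 <= z -> of_real k (scalar_re z) = z.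
Proof. by case: k z => //= z z0; rewrite RRe_real// ger0_real. Qed.

(** The real part of z times its conjugate is |z|^2. This lets an identity known only for real parts
    be upgraded to one of scalars. *)
Lemma scalar_mul_conj_eq0 z : scalar_re (z * scalar_conj z) = 0 -> z = 0.
Proof.
case: k z => /= [z|[a b]].
  by move=> /eqP; rewrite mulf_eq0 orbb => /eqP.
rewrite /= mulrN opprK -!expr2 => /eqP.
by rewrite paddr_eq0 ?sqr_ge0// !sqrf_eq0 => /andP[/eqP -> /eqP ->].
Qed.

End scalars.

Section hilbert.
Context {R : realType} {k : scalar_kind} {H : hilbertType R k}.
Implicit Types (x y z : H) (r : R).

(** Over either field the real part of the inner product is a real inner product with the same norm.
    The estimates are carried out with it, which avoids a case distinction on [k]. *)
Definition rinner x y : R := scalar_re (inner x y).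

Lemma norm_hnorm x : `|x| = of_real k (hnorm x).
Proof. by rewrite of_real_re. Qed.

Lemma hnorm_ge0 x : 0 <= hnorm x.
Proof. by rewrite -(ler_of_real (k := k)) -norm_hnorm of_real0. Qed.

Lemma hnorm0_eq0 x : hnorm x = 0 -> x = 0.
Proof. by move=> x0; apply/normr0_eq0; rewrite norm_hnorm x0 of_real0. Qed.

Lemma hnorm0 : hnorm (0 : H) = 0.
Proof. by rewrite /hnorm normr0 -of_real0 of_realK. Qed.

Lemma hnormN x : hnorm (- x) = hnorm x.
Proof. by rewrite /hnorm normrN. Qed.

Lemma hnormBC x y : hnorm (x - y) = hnorm (y - x).
Proof. by rewrite /hnorm distrC. Qed.

Lemma ler_hnormD x y : hnorm (x + y) <= hnorm x + hnorm y.
Proof.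
by have := ler_normD x y; rewrite !norm_hnorm -of_realD ler_of_real.
Qed.

Lemma innerC x y : inner x y = scalar_conj (inner y x).
Proof. by rewrite [LHS]hermitian_subproof expr0 mul1r. Qed.

Lemma rinnerC x y : rinner x y = rinner y x.
Proof. by rewrite /rinner innerC scalar_re_conj. Qed.

Lemma rinnerDl x y z : rinner (x + y) z = rinner x z + rinner y z.
Proof. by rewrite /rinner linearDl scalar_reD. Qed.

Lemma rinnerDr x y z : rinner z (x + y) = rinner z x + rinner z y.
Proof. by rewrite rinnerC rinnerDl !(rinnerC z). Qed.

Lemma innerZl a x y : inner (a *: x) y = a * inner x y.
Proof. exact: linearZl_LR. Qed.

Lemma rinnerZl r x y : rinner (of_real k r *: x) y = r * rinner x y.
Proof. by rewrite /rinner innerZl scalar_reZ. Qed.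

Lemma rinnerZr r x y : rinner y (of_real k r *: x) = r * rinner y x.
Proof. by rewrite rinnerC rinnerZl rinnerC. Qed.

Lemma rinner0l x : rinner 0 x = 0.
Proof. by rewrite -(scale0r 0) -of_real0 rinnerZl mul0r. Qed.

Lemma rinnerNl x y : rinner (- x) y = - rinner x y.
Proof. by apply/eqP; rewrite -addr_eq0 -rinnerDl addNr rinner0l. Qed.

Lemma rinnerNr x y : rinner y (- x) = - rinner y x.
Proof. by rewrite rinnerC rinnerNl rinnerC. Qed.

Lemma rinnerxx x : rinner x x = hnorm x ^+ 2.
Proof.
by rewrite /rinner inner_norm norm_hnorm !expr2 -of_realM of_realK.
Qed.

Lemma hnormD_sqr x y :
  hnorm (x + y) ^+ 2 = hnorm x ^+ 2 + 2 * rinner x y + hnorm y ^+ 2.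
Proof.
rewrite -!rinnerxx !(rinnerDl, rinnerDr) (rinnerC y x).
by ring.
Qed.

Lemma hnormB_sqr x y :
  hnorm (x - y) ^+ 2 = hnorm x ^+ 2 - 2 * rinner x y + hnorm y ^+ 2.
Proof. by rewrite hnormD_sqr hnormN rinnerNr mulrN. Qed.

Lemma hnormZ r x : hnorm (of_real k r *: x) = `|r| * hnorm x.
Proof.
apply/eqP; rewrite -(eqrXn2 (n := 2))// ?hnorm_ge0 ?mulr_ge0 ?hnorm_ge0//.
rewrite -rinnerxx rinnerZl rinnerZr rinnerxx.
by rewrite exprMn real_normK ?num_real// mulrA -expr2.
Qed.

Lemma hnorm_sqr_le r x : 0 <= r -> hnorm x ^+ 2 <= r ^+ 2 -> hnorm x <= r.
Proof. by move=> r0; rewrite ler_pXn2r// nnegrE ?hnorm_ge0. Qed.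

Lemma parallelogram x y : hnorm (x + y) ^+ 2 + hnorm (x - y) ^+ 2 =
  2 * hnorm x ^+ 2 + 2 * hnorm y ^+ 2.
Proof. by rewrite hnormD_sqr hnormB_sqr; ring. Qed.

(** Cauchy-Schwarz is read off from the triangle inequality, which is already part of the normed
    structure: squaring it bounds the inner product from above, and replacing x by -x bounds it from
    below. *)
Lemma rinner_le x y : `|rinner x y| <= hnorm x * hnorm y.
Proof.
have le a b : rinner a b <= hnorm a * hnorm b.
  have := ler_hnormD a b; rewrite -ler_sqr ?nnegrE ?addr_ge0 ?hnorm_ge0//.
  by rewrite hnormD_sqr; nra.
rewrite ler_norml le andbT -lerN2 opprK -rinnerNl -(hnormN x); exact: le.
Qed.

(** Neighbourhoods in [H] are indexed by positive elements of the scalar field; in the complex case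
    these are exactly the positive reals, so radii translate through [of_real] and [scalar_re]. *)
Lemma cvg_hnormP (T : Type) (F : set_system T) {FF : Filter F} (u : T -> H) x :
  (u @ F --> x) <-> ((fun t => hnorm (u t - x)) @ F --> (0 : R)).
Proof.
split=> [ux|ux].
  apply/cvgrPdist_lt => e e0; have e0' : 0 < of_real k e.
    by rewrite -of_real0 ltr_of_real.
  move/cvgrPdist_lt : ux => /(_ _ e0'); apply: filterS => t.
  rewrite norm_hnorm ltr_of_real hnormBC sub0r normrN ger0_norm//.
  exact: hnorm_ge0.
apply/cvgrPdist_lt => e e0.
have e0' : 0 < scalar_re e by rewrite -(ltr_of_real (k := k)) of_real0 of_real_re// ltW.
move/cvgrPdist_lt : ux => /(_ _ e0'); apply: filterS => t.
rewrite sub0r normrN ger0_norm ?hnorm_ge0//.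
by rewrite norm_hnorm hnormBC -(ltr_of_real (k := k)) (of_real_re (ltW e0)).
Qed.

Lemma cvg_rinnerl (T : Type) (F : set_system T) {FF : Filter F} (u : T -> H) x y :
  u @ F --> x -> (fun t => rinner (u t) y) @ F --> rinner x y.
Proof.
move=> /cvg_hnormP ux; apply/cvgrPdist_lt => e e0.
have hy : 0 < hnorm y + 1 by rewrite ltr_wpDl ?hnorm_ge0.
move/cvgrPdist_lt : ux => /(_ (e / (hnorm y + 1))).
rewrite divr_gt0// => /(_ isT); apply: filterS => t.
rewrite sub0r normrN ger0_norm ?hnorm_ge0// ltr_pdivlMr// => h.
rewrite -rinnerNl -rinnerDl (le_lt_trans (rinner_le _ _))// (le_lt_trans _ h)// hnormBC.
by rewrite ler_wpM2l ?hnorm_ge0// lerDl.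
Qed.

Lemma cvg_hnorm (T : Type) (F : set_system T) {FF : Filter F} (u : T -> H) x :
  u @ F --> x -> (fun t => hnorm (u t)) @ F --> hnorm x.
Proof.
move=> /cvg_hnormP ux; apply/cvgrPdist_lt => e e0.
move/cvgrPdist_lt : ux => /(_ _ e0); apply: filterS => t.
rewrite sub0r normrN ger0_norm ?hnorm_ge0//; apply: le_lt_trans.
have := ler_hnormD (u t) (x - u t); have := ler_hnormD x (u t - x).
rewrite !(addrC _ (_ - _)) !subrK (hnormBC (u t)) => h1 h2.
by rewrite ler_norml; lra.
Qed.

Lemma hilbert_cvg_unique (T : Type) (F : set_system T) {FF : ProperFilter F}
  (u : T -> H) x y : u @ F --> x -> u @ F --> y -> x = y.
Proof. by move=> ux uy; exact: (cvg_unique _ ux uy). Qed.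

Lemma hilbert_cauchy (u : nat -> H) :
  (forall e : R, 0 < e -> exists N, forall m n, (N <= m)%N -> (N <= n)%N ->
     hnorm (u m - u n) < e) -> exists x, u @ \oo --> x.
Proof.
move=> cu; suff : cvg (u @ \oo) by move=> ?; exists (lim (u @ \oo)).
apply/cauchy_cvgP/cauchy_ballP => e e0.
have e0' : 0 < scalar_re e by rewrite -(ltr_of_real (k := k)) of_real0 of_real_re// ltW.
have [N cN] := cu _ e0'.
pose A := u @` [set n | (N <= n)%N].
have fA : (u @ \oo) A by exists N => // n /= Nn; exists n.
exists (A, A) => // -[_ _] [[m Nm <-] [n Nn <-]].
rewrite -ball_normE /= norm_hnorm -(of_real_re (ltW e0)) ltr_of_real.
exact: cN.
Qed.

End hilbert.

(** * Projection-valued measures *)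

Section projection_valued_measure.
Context {R : realType} {k : scalar_kind} {H : hilbertType R k}.
Variables (E : set R -> H -> H) (hE : projection_valued_measure E).
Implicit Types (x y z : H) (r : R) (A B : set R).

Lemma pvmP B : measurable B -> forall a x y, E B (a *: x + y) = a *: E B x + E B y.
Proof. by move=> mB; case: hE => /(_ _ mB)[]. Qed.

Lemma pvm0 B : measurable B -> E B 0 = 0.
Proof.
by move=> mB; have := pvmP mB (-1) 0 0; rewrite scaler0 addr0 scaleN1r addNr.
Qed.

Lemma pvmD B x y : measurable B -> E B (x + y) = E B x + E B y.
Proof. by move=> mB; have := pvmP mB 1 x y; rewrite !scale1r. Qed.

Lemma pvmZ B a x : measurable B -> E B (a *: x) = a *: E B x.
Proof. by move=> mB; have := pvmP mB a x 0; rewrite pvm0// !addr0. Qed.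

Lemma pvmB B x y : measurable B -> E B (x - y) = E B x - E B y.
Proof. by move=> mB; rewrite pvmD// -scaleN1r pvmZ// scaleN1r. Qed.

Lemma pvm_sum B (I : Type) (r : seq I) (F : I -> H) : measurable B ->
  E B (\sum_(i <- r) F i) = \sum_(i <- r) E B (F i).
Proof.
move=> mB; elim: r => [|i r IH]; first by rewrite !big_nil pvm0.
by rewrite !big_cons pvmD// IH.
Qed.

Lemma pvm_idem B x : measurable B -> E B (E B x) = E B x.
Proof. by move=> mB; case: hE => /(_ _ mB)[]. Qed.

Lemma pvm_sym B x y : measurable B -> rinner (E B x) y = rinner x (E B y).
Proof. by move=> mB; rewrite /rinner; case: hE => /(_ _ mB)[_ _ ->]. Qed.

Lemma pvmT x : E setT x = x.
Proof. by case: hE. Qed.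

Lemma pvm_rinner B x : measurable B -> rinner (E B x) x = hnorm (E B x) ^+ 2.
Proof. by move=> mB; rewrite -rinnerxx (pvm_sym x (E B x))// pvm_idem// rinnerC. Qed.

Lemma pvm_le B x : measurable B -> hnorm (E B x) <= hnorm x.
Proof.
move=> mB; apply: hnorm_sqr_le; first exact: hnorm_ge0.
have := hnormB_sqr x (E B x); rewrite rinnerC pvm_rinner//.
by have := sqr_ge0 (hnorm (x - E B x)); nra.
Qed.

Lemma pvm_sigma (F : (set R)^nat) x : (forall i, measurable (F i)) ->
  trivIset setT F ->
  (fun n => \sum_(i < n) E (F i) x) @ \oo --> E (\bigcup_i F i) x.
Proof. by case: hE => _ _; apply. Qed.

(** For the constant sequence of empty sets, consecutive partial sums differ by [E set0 x], and the
    differences of a convergent sequence tend to 0. *)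
Lemma pvm_set0 x : E set0 x = 0.
Proof.
have := @pvm_sigma (fun=> set0) x (fun=> measurable0).
rewrite bigcup0// => /(_ _)/wrap[|s].
  by apply/trivIsetP => *; rewrite set0I.
have s' := s; rewrite -cvg_shiftS in s'.
have := cvgB s' s; rewrite subrr => ss.
have s0 : (fun _ : nat => E set0 x) @ \oo --> (0 : H).
  rewrite [X in X @ _ --> _](_ : _ =
    (fun n => \sum_(i < n.+1) E set0 x - \sum_(i < n) E set0 x)); first exact: ss.
  by apply/funext => n; rewrite big_ord_recr /= addrAC subrr add0r.
exact: hilbert_cvg_unique (cvg_cst _) s0.
Qed.

Lemma pvmU A B x : measurable A -> measurable B -> A `&` B = set0 ->
  E (A `|` B) x = E A x + E B x.
Proof.
move=> mA mB AB; have := @pvm_sigma (bigcup2 A B) x.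
rewrite bigcup2E => /(_ _)/wrap[|]; first by move=> [|[|i]] /=.
move=> /(_ _)/wrap[|]; first by rewrite -trivIset_bigcup2.
move=> s; apply: hilbert_cvg_unique s _.
apply: cvg_near_cst; exists 2%N => // -[|[|n]] //= _.
rewrite 2!big_ord_recl /= big1 ?addr0// => i _; exact: pvm_set0.
Qed.

(** With y = E(B)x, additivity gives |E(A U B)y|^2 = |E(A)y|^2 + |y|^2, while a projection does not
    increase the norm. *)
Lemma pvm_disjoint A B x : measurable A -> measurable B -> A `&` B = set0 ->
  E A (E B x) = 0.
Proof.
move=> mA mB AB; apply/hnorm0_eq0/eqP; rewrite -sqrf_eq0 eq_le sqr_ge0 andbT.
have mAB := measurableU _ _ mA mB.
set y := E B x; have yB : E B y = y by rewrite /y pvm_idem.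
have := pvm_rinner y mAB; rewrite pvmU// rinnerDl !pvm_rinner// yB.
have := pvm_le y mAB; rewrite -(ler_pXn2r (n := 2)) ?nnegrE ?hnorm_ge0//.
by rewrite pvmU// yB => h1 h2; nra.
Qed.

(** Both projections are split along the intersection; the pieces of A and B outside it meet nothing
    of the other and contribute 0. *)
Lemma pvmI A B x : measurable A -> measurable B -> E A (E B x) = E (A `&` B) x.
Proof.
move=> mA mB; have mI := measurableI _ _ mA mB.
have eD C D z : measurable C -> measurable D -> E C z = E (C `&` D) z + E (C `\` D) z.
  move=> mC mD; rewrite -pvmU.
  - by rewrite setUIDK.
  - exact: measurableI.
  - exact: measurableD.
  - by rewrite -subset0 => t [[_ ?] [_]].
rewrite (eD B A)// pvmD// (setIC B A) (eD A B (E (A `&` B) x))// pvm_idem//.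
rewrite !pvm_disjoint ?addr0//; try exact: measurableD.
- by rewrite -subset0 => t [? [_]].
- by rewrite -subset0 => t [[_ ?] [_ ?]].
Qed.

Lemma spectral_mass0 x : spectral_mass E x set0 = 0%E.
Proof. by rewrite /spectral_mass pvm_set0 hnorm0 expr0n. Qed.

Lemma spectral_mass_ge0 x A : (0 <= spectral_mass E x A)%E.
Proof. by rewrite lee_fin sqr_ge0. Qed.

(** Since |E(B)x|^2 = <E(B)x, x> is linear in E(B)x, strong convergence of the vector series passes
    to the masses. *)
Lemma spectral_mass_sigma_additive x : semi_sigma_additive (spectral_mass E x).
Proof.
move=> F mF tF mU; have := cvg_rinnerl (y := x) (@pvm_sigma F x mF tF).
rewrite pvm_rinner// => h.
rewrite (_ : (fun n => _) = EFin \o (fun n => rinner (\sum_(i < n) E (F i) x) x)).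
  by apply: cvg_EFin; [exact: nearW|exact: h].
apply/funext => n /=; rewrite big_mkord /spectral_mass sumEFin; congr EFin.
elim/big_rec2 : _ => [|i a b _ ->]; first by rewrite rinner0l.
by rewrite rinnerDl pvm_rinner.
Qed.

End projection_valued_measure.

Section spectral_measure.
Context {R : realType} {k : scalar_kind} {H : hilbertType R k}.
Variables (E : set R -> H -> H) (hE : projection_valued_measure E).

(* The proof argument lets the measure structure be inferred from the term. *)
Definition spectral_measure (_ : projection_valued_measure E) (x : H) :
  set R -> \bar R := spectral_mass E x.

HB.instance Definition _ x := isMeasure.Build _ _ _ (spectral_measure hE x)
  (spectral_mass0 hE x) (@spectral_mass_ge0 _ _ _ E x)
  (@spectral_mass_sigma_additive _ _ _ _ hE x).

End spectral_measure.

(** * Spectral integrals of simple functions *)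

Section simple_spectral_integral.
Context {R : realType} {k : scalar_kind} {H : hilbertType R k}.
Variables (E : set R -> H -> H) (hE : projection_valued_measure E).
Implicit Types (x y z : H) (r c d : R) (A B : set R) (phi psi : {sfun R >-> R}).

(** The set [A] is arbitrary: only its trace on the finite range of [phi] matters, and finite sets
    are measurable. *)
Lemma sfun_preimage_measurable phi A : measurable (phi @^-1` A).
Proof.
rewrite (_ : phi @^-1` A = phi @^-1` (A `&` range phi)).
  rewrite -[X in measurable X]setTI; apply: measurable_funPT => //.
  apply/countable_measurable/finite_set_countable => //.
  exact/finite_setIr/fimfunP.
by apply/seteqP; split=> t /= => [At|[]//]; split=> //; exists t.
Qed.

Lemma simple_spectral_integralE phi x : simple_spectral_integral E phi x =
  \sum_(c <- fset_set (range phi)) of_real k c *: E (phi @^-1` [set c]) x.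
Proof. by rewrite /simple_spectral_integral fsbig_finite//; exact: fimfunP. Qed.

Lemma pvm_range phi x :
  x = \sum_(c <- fset_set (range phi)) E (phi @^-1` [set c]) x.
Proof.
have mphi := sfun_preimage_measurable phi.
(* The induction runs over duplicate-free lists of values, so that the fibre of a new head is
   disjoint from the fibres of the tail. *)
suff H' (s : seq R) : uniq s ->
    E (phi @^-1` [set` s]) x = \sum_(c <- s) E (phi @^-1` [set c]) x.
  rewrite -H' ?fset_uniq// -[LHS](pvmT hE); congr (E _ x).
  apply/seteqP; split => t //= _.
  by rewrite in_fset_set ?inE//; exact: fimfunP.
elim: s => [_|c s IH /= /andP[cs us]].
  by rewrite big_nil (_ : _ @^-1` _ = set0) ?(pvm_set0 hE)// -subset0 => t.
rewrite big_cons -IH// -(pvmU hE)//; last first.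
  by rewrite -subset0 => t /= [-> h]; rewrite h in cs.
congr (E _ x); apply/seteqP; split => t /=; rewrite inE.
  by move=> /orP[/eqP|]; [left|right].
by move=> [->|->]; rewrite ?eqxx ?orbT.
Qed.

(** After projection to a set where [phi] is constant, the operator is a scalar. Together with
    [pvm_eq2] this reduces algebraic identities between operators to identities between values. *)
Lemma pvm_simple_spectral_integral phi x B c : measurable B ->
  (forall t, B t -> phi t = c) ->
  E B (simple_spectral_integral E phi x) = of_real k c *: E B x.
Proof.
move=> mB Bc; rewrite simple_spectral_integralE (pvm_sum hE)//.
rewrite [in RHS](pvm_range phi x) (pvm_sum hE)// scaler_sumr.
apply: eq_bigr => d _; rewrite (pvmZ hE)// (pvmI hE)//.
have [->//|dc] := eqVneq d c.
rewrite (_ : _ `&` _ = set0) ?(pvm_set0 hE) ?scaler0//.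
by rewrite -subset0 => t [/Bc Bt] /=; rewrite Bt => /esym /eqP; rewrite (negbTE dc).
Qed.

(* Vectors are compared on the common refinement of two finite partitions. *)
Lemma pvm_eq2 phi psi x y :
  (forall c d, let B := phi @^-1` [set c] `&` psi @^-1` [set d] in
    E B x = E B y) -> x = y.
Proof.
move=> xy; rewrite (pvm_range phi x) (pvm_range phi y); apply: eq_bigr => c _.
rewrite (pvm_range psi (E _ x)) (pvm_range psi (E _ y)); apply: eq_bigr => d _.
by rewrite !(pvmI hE) ?(setIC (psi @^-1` _)) ?xy.
Qed.

Local Notation S := (simple_spectral_integral E).

Lemma simple_spectral_integralB phi psi x : S (phi - psi) x = S phi x - S psi x.
Proof.
apply: (@pvm_eq2 phi psi) => c d B.
have mB : measurable B by apply: measurableI; exact: sfun_preimage_measurable.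
rewrite (pvmB hE)// (@pvm_simple_spectral_integral _ _ _ (c - d))//.
  rewrite (@pvm_simple_spectral_integral _ _ _ c)//; last by move=> t [].
  rewrite (@pvm_simple_spectral_integral _ _ _ d)//; last by move=> t [].
  by rewrite of_realB scalerBl.
by move=> t [/= <- <-].
Qed.

Lemma simple_spectral_integralM phi psi x : S (phi * psi) x = S phi (S psi x).
Proof.
apply: (@pvm_eq2 phi psi) => c d B.
have mB : measurable B by apply: measurableI; exact: sfun_preimage_measurable.
rewrite (@pvm_simple_spectral_integral _ _ _ (c * d))//.
  rewrite (@pvm_simple_spectral_integral _ _ _ c)//; last by move=> t [].
  rewrite (@pvm_simple_spectral_integral _ _ _ d)//; last by move=> t [].
  by rewrite of_realM scalerA.
by move=> t [/= <- <-].
Qed.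

Lemma simple_spectral_integral_cst c x : S (cst_sfun c) x = of_real k c *: x.
Proof.
rewrite -[LHS](pvmT hE) (@pvm_simple_spectral_integral _ _ _ c)// (pvmT hE)//.
Qed.

Lemma simple_spectral_integral_indic B (mB : measurable B) x :
  S (indic_sfun B mB) x = E B x.
Proof.
apply: (@pvm_eq2 (indic_sfun B mB) (indic_sfun B mB)) => c d A.
have mA : measurable A by apply: measurableI; exact: sfun_preimage_measurable.
rewrite (@pvm_simple_spectral_integral _ _ _ c)//; last by move=> t [].
rewrite (pvmI hE)//.
have AE t : A t -> (t \in B)%:R = c.
  by move=> [<- _]; rewrite /= /mindic indicE.
have [c0|c0] := eqVneq c 0.
  rewrite c0 of_real0 scale0r (_ : _ `&` _ = set0) ?(pvm_set0 hE)//.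
  rewrite -subset0 => t [/AE + Bt]; rewrite c0 mem_set//.
  by move/eqP; rewrite oner_eq0.
have [c1|c1] := eqVneq c 1.
  rewrite c1 of_real1 scale1r setIidl// => t /AE; rewrite c1.
  by case: (boolP (t \in B)) => [|_ /eqP]; rewrite ?inE// eq_sym oner_eq0.
(* A value [c] other than 0 and 1 has an empty fibre. *)
rewrite (_ : A = set0) ?set0I ?(pvm_set0 hE) ?scaler0//.
rewrite -subset0 => t /AE.
by case: (t \in B) => /esym /eqP; rewrite ?(negbTE c0) ?(negbTE c1).
Qed.

(** Distinct fibres have orthogonal projections, so both sides equal the sum of c^2 |E(phi = c)x|^2
    over the values c. *)
Lemma hnorm_simple_spectral_integral phi x :
  ((hnorm (S phi x) ^+ 2)%:E =
  \int[spectral_mass E x]_t ((phi t ^+ 2)%:E))%E.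
Proof.
have mphi := sfun_preimage_measurable phi.
transitivity (\sum_(c <- fset_set (range phi))
    (c ^+ 2)%:E * spectral_measure hE x (phi @^-1` [set c]))%E.
  rewrite -rinnerxx {1}simple_spectral_integralE.
  transitivity (\sum_(c <- fset_set (range phi))
      c ^+ 2 * hnorm (E (phi @^-1` [set c]) x) ^+ 2)%:E; last first.
    by rewrite -sumEFin; apply: eq_bigr.
  congr EFin.
  elim: (enum_fset _) => [|c s IH]; rewrite ?big_nil ?rinner0l// !big_cons.
  rewrite rinnerDl rinnerZl -IH; congr (_ + _).
  rewrite (pvm_sym hE)// (@pvm_simple_spectral_integral _ _ _ c)//.
  by rewrite rinnerZr rinnerC (pvm_rinner hE)// mulrA -expr2.
transitivity (\int[spectral_measure hE x]_t
  \sum_(c <- fset_set (range phi)) (c ^+ 2)%:E * (\1_(phi @^-1` [set c]) t)%:E)%E.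
  rewrite ge0_integral_sum//=; last first.
  - by move=> c t _; rewrite mule_ge0// lee_fin ?sqr_ge0.
  - move=> c; apply: measurable_funeM; apply/measurable_EFinP.
    exact: measurable_indic.
  apply: eq_bigr => c _; rewrite ge0_integralZl//; last 2 first.
  - by apply/measurable_EFinP; exact: measurable_indic.
  - by rewrite lee_fin sqr_ge0.
  by rewrite integral_indic// setIT.
apply: eq_integral => t _.
rewrite (big_fsetD1 (phi t)) /=; last first.
  by rewrite in_fset_set ?inE.
rewrite indicE mem_set// mule1 big1_seq ?adde0// => c /andP[_].
rewrite !inE => /andP[/negbTE ct _]; rewrite indicE memNset ?mule0// => /= /esym /eqP.
by rewrite ct.
Qed.

End simple_spectral_integral.

(** * Square integrals *)

Lemma cvge0_lt (R : realType) (T : Type) (F : set_system T) {FF : Filter F}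
  (u : T -> \bar R) (e : R) : u @ F --> 0%E -> 0 < e ->
  \forall t \near F, (u t < e%:E)%E.
Proof.
move=> u0 e0; apply: (u0 (fun y => (y < e%:E)%E)).
by apply: open_ereal_lt'; rewrite lte_fin.
Qed.

Section square_integral.
Context d (T : measurableType d) (R : realType) (mu : {measure set T -> \bar R}).
Implicit Types f g h : T -> R.

Local Notation sqint f := (\int[mu]_t ((f t ^+ 2)%:E))%E.

Lemma measurable_sqr f : measurable_fun setT f ->
  measurable_fun setT (fun t => (f t ^+ 2)%:E).
Proof. by move=> mf; apply/measurable_EFinP; exact: measurable_funX. Qed.

Lemma sqint_ge0 f : (0 <= sqint f)%E.
Proof. by apply: integral_ge0 => t _; rewrite lee_fin sqr_ge0. Qed.

Lemma sqint_eq0 f : (forall t, f t = 0) -> sqint f = 0%E.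
Proof. by move=> f0; apply: integral0_eq => t _; rewrite f0 expr0n. Qed.

Lemma sqint_le f g : measurable_fun setT f -> measurable_fun setT g ->
  (forall t, `|f t| <= `|g t|) -> (sqint f <= sqint g)%E.
Proof.
move=> mf mg fg; apply: ge0_le_integral => //.
- by move=> t _; rewrite lee_fin sqr_ge0.
- exact: measurable_sqr.
- exact: measurable_sqr.
- move=> t _; rewrite lee_fin -real_normK ?num_real//.
  by rewrite -[leRHS]real_normK ?num_real// ler_sqr ?nnegrE.
Qed.

Lemma sqintZ f c : measurable_fun setT f ->
  (\int[mu]_t (((c * f t) ^+ 2)%:E) = (c ^+ 2)%:E * sqint f)%E.
Proof.
move=> mf; rewrite -ge0_integralZl//.
- by apply: eq_integral => t _; rewrite exprMn EFinM.
- exact: measurable_sqr.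
- by move=> t _; rewrite lee_fin sqr_ge0.
- by rewrite lee_fin sqr_ge0.
Qed.

(* Young's inequality; letting r tend to 0 makes it as good as Minkowski's. *)
Lemma sqintD_le f g h r : measurable_fun setT f -> measurable_fun setT g ->
  measurable_fun setT h -> 0 < r -> (forall t, `|h t| <= `|f t| + `|g t|) ->
  (sqint h <= (1 + r)%:E * sqint f + (1 + r^-1)%:E * sqint g)%E.
Proof.
move=> mf mg mh r0 hfg; have r0' : 0 < r^-1 by rewrite invr_gt0.
rewrite -!ge0_integralZl//=; try (by move=> t _; rewrite lee_fin sqr_ge0);
  try (by rewrite lee_fin addr_ge0 ?ltW); try exact: measurable_sqr.
rewrite -ge0_integralD//=; last 4 first.
- by move=> t _; rewrite -EFinM lee_fin mulr_ge0 ?sqr_ge0// addr_ge0 ?ltW.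
- by apply: measurable_funeM; exact: measurable_sqr.
- by move=> t _; rewrite -EFinM lee_fin mulr_ge0 ?sqr_ge0// addr_ge0 ?ltW.
- by apply: measurable_funeM; exact: measurable_sqr.
apply: ge0_le_integral => //.
- by move=> t _; rewrite lee_fin sqr_ge0.
- exact: measurable_sqr.
- by apply: emeasurable_funD; apply: measurable_funeM; exact: measurable_sqr.
move=> t _; rewrite -!EFinM -EFinD lee_fin.
have h2 : h t ^+ 2 <= (`|f t| + `|g t|) ^+ 2.
  by rewrite -real_normK ?num_real// ler_sqr ?nnegrE ?addr_ge0.
apply: (le_trans h2).
rewrite -(real_normK (num_real (f t))) -(real_normK (num_real (g t))) -subr_ge0.
set a := `|f t|; set b := `|g t|.
rewrite (_ : _ - _ = r^-1 * (r * a - b) ^+ 2); last by field; rewrite gt_eqF.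
by rewrite mulr_ge0 ?sqr_ge0 ?ltW.
Qed.

Lemma cvg_sqint_add (f_ g_ h_ : nat -> T -> R) :
  (forall n, measurable_fun setT (f_ n)) -> (forall n, measurable_fun setT (g_ n)) ->
  (forall n, measurable_fun setT (h_ n)) ->
  (forall n t, `|h_ n t| <= `|f_ n t| + `|g_ n t|) ->
  (fun n => sqint (f_ n)) @ \oo --> 0%E -> (fun n => sqint (g_ n)) @ \oo --> 0%E ->
  (fun n => sqint (h_ n)) @ \oo --> 0%E.
Proof.
move=> mf mg mh hfg f0 g0.
have s0 : (fun n => (1 + 1)%:E * sqint (f_ n) +
    (1 + 1^-1)%:E * sqint (g_ n))%E @ \oo --> 0%E.
  rewrite -[X in _ --> X](adde0 0)%E -[X in _ --> (X + _)%E](mule0 (1 + 1)%:E)%E.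
  rewrite -[X in _ --> (_ + X)%E](mule0 (1 + 1^-1)%:E)%E.
  by apply: cvgeD; [rewrite !mule0|exact: cvgeZl|exact: cvgeZl].
apply: (squeeze_cvge _ (cvg_cst 0%E) s0); apply: nearW => n.
by rewrite sqint_ge0/= (sqintD_le (mf n) (mg n))// ltr01.
Qed.

(** This is continuity of the L^2 norm. Young's inequality compares f with f_n in both directions at
    the cost of a factor 1 + r; first n tends to infinity, then r to 0. *)
Lemma cvg_sqint_lim f (f_ : nat -> T -> R) (l : R) :
  measurable_fun setT f -> (forall n, measurable_fun setT (f_ n)) ->
  (fun n => \int[mu]_t (((f t - f_ n t) ^+ 2)%:E))%E @ \oo --> 0%E ->
  (fun n => sqint (f_ n)) @ \oo --> l%:E -> sqint f = l%:E.
Proof.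
move=> mf mf_ f0 fl.
have mB n : measurable_fun setT (fun t => f t - f_ n t) by exact: measurable_funB.
have l0 : 0 <= l.
  by rewrite -lee_fin; apply: (cvge_to_ge fl); apply: nearW => n; exact: sqint_ge0.
have up r : 0 < r -> (sqint f <= ((1 + r) * l)%:E)%E.
  move=> r0.
  have s0 : (fun n => (1 + r)%:E * sqint (f_ n) + (1 + r^-1)%:E *
      \int[mu]_t (((f t - f_ n t) ^+ 2)%:E))%E @ \oo --> ((1 + r) * l)%:E%E.
    rewrite -[X in _ --> X]adde0 EFinM -[X in _ --> (_ + X)%E](mule0 (1 + r^-1)%:E)%E.
    by apply: cvgeD; [by rewrite mule0 fin_num_adde_defl|exact: cvgeZl|exact: cvgeZl].
  apply: (cvge_to_ge s0); apply: nearW => n.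
  apply: sqintD_le => // t; rewrite -{1}(subrK (f_ n t) (f t)) addrC; exact: ler_normD.
(* The upper bound at r = 1 excludes the value +oo, so the reverse comparison takes place between
   real numbers. *)
have [Q fQ] : exists Q, sqint f = Q%:E.
  have := up _ ltr01; have := sqint_ge0 f.
  by case: (sqint f) => // Q _ _; exists Q.
have Q0 : 0 <= Q by rewrite -lee_fin -fQ sqint_ge0.
have dn r : 0 < r -> l <= (1 + r) * Q.
  move=> r0.
  have s0 : (fun n => (1 + r)%:E * sqint f + (1 + r^-1)%:E *
      \int[mu]_t (((f t - f_ n t) ^+ 2)%:E))%E @ \oo --> ((1 + r) * Q)%:E%E.
    rewrite -[X in _ --> X]adde0 EFinM -fQ -[X in _ --> (_ + X)%E](mule0 (1 + r^-1)%:E)%E.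
    by apply: cvgeD; [by rewrite mule0 fin_num_adde_defl|exact: cvg_cst|exact: cvgeZl].
  rewrite -lee_fin -(cvg_lim _ fl)// -(cvg_lim _ s0)//.
  apply: lee_lim; [exact: cvgP fl|exact: cvgP s0|apply: nearW => n].
  apply: sqintD_le => // t.
  by rewrite -{1}(subrK (f t) (f_ n t)) addrC (le_trans (ler_normD _ _))// lerD2l distrC.
rewrite fQ; congr EFin; apply/eqP.
(* With r = e / (v + 1) the excess r v is at most e; the added 1 covers v = 0. *)
have le_lim (u v : R) : 0 <= v -> (forall r, 0 < r -> u <= (1 + r) * v) -> u <= v.
  move=> v0 uv; apply/ler_addgt0Pr => e e0.
  have v1 : 0 < v + 1 by rewrite ltr_wpDl.
  apply: (le_trans (uv (e / (v + 1)) _)); first by rewrite divr_gt0.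
  rewrite mulrDl mul1r lerD2l -mulrA.
  by apply: ler_piMr; rewrite ?(ltW e0)// ler_pdivrMl// mulr1 lerDl.
rewrite eq_le; apply/andP; split; apply: le_lim => // r /up.
by rewrite fQ lee_fin.
Qed.

Lemma nonneg_sfun_approx f : measurable_fun setT f -> (forall t, 0 <= f t) ->
  exists phi : nat -> {sfun T >-> R},
  [/\ forall n t, 0 <= phi n t <= f t,
      forall t, nondecreasing_seq (fun n => phi n t) &
      forall t, (fun n => phi n t) @ \oo --> f t].
Proof.
move=> mf f0; have mf' : measurable_fun setT (EFin \o f) by exact/measurable_EFinP.
pose p n : {sfun T >-> R} := nnsfun_approx measurableT mf' n.
exists p.
have nd t : nondecreasing_seq (fun n => p n t).
  by move=> m n mn; have /(_ m n mn)/asboolP := nd_nnsfun_approx measurableT mf'; exact.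
have cv t : (fun n => p n t) @ \oo --> f t.
  have := cvg_nnsfun_approx measurableT mf' (fun t _ => f0 t) (x := t) I.
  by move=> /fine_cvgP[].
split=> // n t; apply/andP; split; first exact: fun_ge0.
have := nondecreasing_cvgn_le (nd t) (cvgP _ (cv t)) n.
by rewrite (cvg_lim _ (cv t)).
Qed.

(** Approximating the positive and negative parts from below keeps |f - phi_n| <= |f|, so f^2 is an
    integrable bound for dominated convergence. *)
Lemma sqint_sfun_approx f : measurable_fun setT f -> (sqint f < +oo)%E ->
  exists phi : nat -> {sfun T >-> R},
  (fun n => \int[mu]_t (((f t - phi n t) ^+ 2)%:E))%E @ \oo --> 0%E.
Proof.
move=> mf foo.
have mp : measurable_fun setT (fun t => Num.max (f t) 0) by exact: measurable_maxr.
have mm : measurable_fun setT (fun t => Num.max (- f t) 0).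
  by apply: measurable_maxr => //; exact: measurableT_comp.
have [p [p1 _ p2]] := nonneg_sfun_approx mp (fun t => ltac:(by rewrite le_max lexx orbT)).
have [m [m1 _ m2]] := nonneg_sfun_approx mm (fun t => ltac:(by rewrite le_max lexx orbT)).
pose phi n : {sfun T >-> R} := p n - m n.
exists phi.
have mphi n : measurable_fun setT (fun t => f t - phi n t) by exact: measurable_funB.
have cphi t : (fun n => phi n t) @ \oo --> f t.
  have fE : Num.max (f t) 0 - Num.max (- f t) 0 = f t.
    by rewrite /Num.max; case: (ltP (f t) 0) => ?; case: (ltP (- f t) 0) => ?; lra.
  rewrite -[X in _ --> X]fE; exact: cvgB (p2 t) (m2 t).
have bphi n t : `|f t - phi n t| <= `|f t|.
  have := p1 n t; have := m1 n t; rewrite /phi /= -[(_ - _) t]/(p n t - m n t).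
  rewrite ler_norml /Num.max.
  by case: (ltP (f t) 0) => ?; case: (ltP (- f t) 0) => ? /andP[? ?] /andP[? ?];
     case: (ger0P (f t)) => ?; lra.
have [] := @dominated_convergence _ T R mu setT measurableT
  (fun n t => ((f t - phi n t) ^+ 2)%:E) (cst 0%E) (fun t => (f t ^+ 2)%:E).
- by move=> n; exact: measurable_sqr.
- exact: measurable_cst.
- apply: aeW => t _; apply: cvg_EFin; first exact: nearW.
  have h : (fun n => f t - phi n t) @ \oo --> (0 : R).
    by rewrite -(subrr (f t)); apply: cvgB => //; exact: cvg_cst.
  by rewrite -[X in _ --> X](mulr0 0); exact: (cvgM h h).
- apply/integrableP; split; first exact: measurable_sqr.
  by under eq_integral do rewrite gee0_abs ?lee_fin ?sqr_ge0//.
- apply: aeW => t n _; rewrite gee0_abs ?lee_fin ?sqr_ge0//.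
  by rewrite -real_normK ?num_real// -[leRHS]real_normK ?num_real// ler_sqr ?nnegrE.
by rewrite integral0.
Qed.

End square_integral.

(** * Spectral integrals *)

Section spectral_integral.
Context {R : realType} {k : scalar_kind} {H : hilbertType R k}.
Variables (E : set R -> H -> H) (hE : projection_valued_measure E).
Implicit Types (x y z u v : H) (f g : R -> R) (phi psi : {sfun R >-> R}).

Local Notation S := (simple_spectral_integral E).
Local Notation sqint x f := (\int[spectral_measure hE x%R]_t ((f t ^+ 2)%:E))%E.

(** The isometry passes from simple functions to their L^2 limits. Stating it for a difference
    yields the norm formula by taking g = 0 and uniqueness by taking g = f. *)
Lemma is_spectral_integral_isometry f g x u v :
  is_spectral_integral E f x u -> is_spectral_integral E g x v ->
  sqint x (fun t => f t - g t) = (hnorm (u - v) ^+ 2)%:E.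
Proof.
move=> [mf [phi [fphi phiu]]] [mg [psi [gpsi psiv]]].
pose chi n : {sfun R >-> R} := phi n - psi n.
apply: (@cvg_sqint_lim _ _ _ _ (fun t => f t - g t) (fun n => chi n)).
- exact: measurable_funB.
- by move=> n; exact: measurable_funPT.
- have fphi' : (fun n => sqint x (fun t => f t - phi n t)) @ \oo --> 0%E := fphi.
  have gpsi' : (fun n => sqint x (fun t => g t - psi n t)) @ \oo --> 0%E := gpsi.
  have mfp n : measurable_fun setT (fun t => f t - phi n t).
    by apply: measurable_funB => //; exact: measurable_funPT.
  have mgp n : measurable_fun setT (fun t => g t - psi n t).
    by apply: measurable_funB => //; exact: measurable_funPT.
  have mfg n : measurable_fun setT (fun t => f t - g t - chi n t).
    by apply: measurable_funB; [exact: measurable_funB|exact: measurable_funPT].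
  have le n t : `|f t - g t - chi n t| <= `|f t - phi n t| + `|g t - psi n t|.
    rewrite -[chi n t]/(phi n t - psi n t).
    rewrite (_ : _ - _ = (f t - phi n t) - (g t - psi n t)); last by ring.
    exact: ler_normB.
  have := cvg_sqint_add mfp mgp mfg le fphi' gpsi'.
  exact.
- rewrite (_ : (fun n => _) =
      EFin \o (fun n => hnorm (S (phi n) x - S (psi n) x) ^+ 2)); last first.
    apply/funext => n /=; rewrite -(simple_spectral_integralB hE).
    by rewrite (hnorm_simple_spectral_integral hE).
  apply: cvg_EFin; first exact: nearW.
  have h : (fun n => hnorm (S (phi n) x - S (psi n) x)) @ \oo --> hnorm (u - v).
    by apply: cvg_hnorm; exact: cvgB phiu psiv.
  exact: (cvgM h h).
Qed.

Lemma simple_is_spectral_integral phi x : is_spectral_integral E phi x (S phi x).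
Proof.
split; first exact: measurable_funPT.
exists (fun=> phi); split; last exact: cvg_cst.
rewrite (_ : (fun n => _) = cst 0%E); first exact: cvg_cst.
apply/funext => n.
by apply: (sqint_eq0 (spectral_measure hE x)) => t; rewrite subrr.
Qed.

Lemma cst_is_spectral_integral c x : is_spectral_integral E (cst c) x (of_real k c *: x).
Proof.
rewrite -(simple_spectral_integral_cst hE).
exact: simple_is_spectral_integral (cst_sfun c) x.
Qed.

Lemma hnorm_is_spectral_integral f x u :
  is_spectral_integral E f x u -> sqint x f = (hnorm u ^+ 2)%:E.
Proof.
move=> /is_spectral_integral_isometry /(_ (cst_is_spectral_integral 0 x)).
rewrite of_real0 scale0r subr0 => <-.
by apply: eq_integral => t _; rewrite subr0.
Qed.

Lemma is_spectral_integral_unique f x u v :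
  is_spectral_integral E f x u -> is_spectral_integral E f x v -> u = v.
Proof.
move=> fu /(is_spectral_integral_isometry fu).
rewrite sqint_eq0; last by move=> t; rewrite subrr.
move=> /esym/eqP; rewrite eqe sqrf_eq0 => /eqP /hnorm0_eq0 /eqP.
by rewrite subr_eq0 => /eqP.
Qed.

Lemma is_spectral_integral_exists f x : measurable_fun setT f ->
  (sqint x f < +oo)%E -> exists u, is_spectral_integral E f x u.
Proof.
move=> mf foo; have [phi fphi] := sqint_sfun_approx mf foo.
have [u phiu] : exists u, (fun n => S (phi n) x) @ \oo --> u; last first.
  by exists u; split=> //; exists phi.
apply: hilbert_cauchy => e e0.
(* Young's inequality with r = 1 puts a factor 2 on each of the two errors, so two errors below e^2
   / 4 add up to less than e^2. *)
have e4 : 0 < e ^+ 2 / 4 by rewrite divr_gt0// exprn_gt0.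
have [N _ hN] := cvge0_lt fphi e4.
exists N => m n /hN hm /hN hn.
pose chi : {sfun R >-> R} := phi m - phi n.
have : ((hnorm (S (phi m) x - S (phi n) x) ^+ 2)%:E < (e ^+ 2)%:E)%E.
  rewrite -(simple_spectral_integralB hE) (hnorm_simple_spectral_integral hE).
  apply: (@le_lt_trans _ _ (
      (1 + 1)%:E * sqint x (fun t => (f t - phi m t)%R) +
      (1 + 1^-1)%:E * sqint x (fun t => (f t - phi n t)%R))%E).
    apply: (@sqintD_le _ _ _ (spectral_measure hE x) _ _ chi) => //.
    + by apply: measurable_funB => //; exact: measurable_funPT.
    + by apply: measurable_funB => //; exact: measurable_funPT.
    + move=> t; rewrite -[chi t]/(phi m t - phi n t).
      rewrite [leRHS]addrC.
      rewrite (_ : phi m t - phi n t = (f t - phi n t) - (f t - phi m t)); last by ring.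
      exact: ler_normB.
  rewrite (_ : (e ^+ 2)%:E =
      (1 + 1)%:E * (e ^+ 2 / 4)%:E + (1 + 1^-1)%:E * (e ^+ 2 / 4)%:E)%E.
    by apply: lteD; rewrite lte_pmul2l// lte_fin invr1 ltr_wpDl.
  by rewrite -!EFinM -EFinD; congr EFin; field.
by rewrite lte_fin ltr_sqr ?nnegrE ?hnorm_ge0 ?ltW.
Qed.

(** A diagonal choice: the n-th simple function is taken within 1 / (n + 1) of [f_ n] in squared L^2
    distance, with its integral equally close to [u_ n]. *)
Lemma is_spectral_integral_closed f (f_ : nat -> R -> R) x u (u_ : nat -> H) :
  measurable_fun setT f -> (forall n, is_spectral_integral E (f_ n) x (u_ n)) ->
  (fun n => sqint x (fun t => f t - f_ n t)) @ \oo --> 0%E ->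
  u_ @ \oo --> u -> is_spectral_integral E f x u.
Proof.
move=> mf fu f0 uu; split=> //.
have /choice[phi phiP] n : exists phi : {sfun R >-> R},
    (sqint x (fun t => f_ n t - phi t) <= (n.+1%:R^-1)%:E)%E /\
    hnorm (S phi x - u_ n) <= n.+1%:R^-1.
  have [_ [phi [p1 p2]]] := fu n.
  have n0 : (0 : R) < n.+1%:R^-1 by rewrite invr_gt0.
  have /cvg_hnormP/cvgrPdist_lt/(_ _ n0) h2 := p2.
  have [m [m1 m2]] := filter_ex (filterI (cvge0_lt p1 n0) h2).
  exists (phi m); split; first exact: ltW.
  by move: m2; rewrite /= sub0r normrN => /ltW; rewrite ger0_norm ?hnorm_ge0.
exists phi; split.
  have h0 : (fun n => sqint x (fun t => f_ n t - phi n t)) @ \oo --> 0%E.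
    apply: (squeeze_cvge _ (cvg_cst 0%E) cvge_harmonic); apply: nearW => n.
    by rewrite sqint_ge0 (phiP n).1.
  have mffn n : measurable_fun setT (fun t => f t - f_ n t).
    by apply: measurable_funB => //; exact: (fu n).1.
  have mfp n : measurable_fun setT (fun t => f_ n t - phi n t).
    by apply: measurable_funB; [exact: (fu n).1|exact: measurable_funPT].
  have mfphi n : measurable_fun setT (fun t => f t - phi n t).
    by apply: measurable_funB => //; exact: measurable_funPT.
  have le n t : `|f t - phi n t| <= `|f t - f_ n t| + `|f_ n t - phi n t|.
    by rewrite -(subrKA (f_ n t)); exact: ler_normD.
  by have := cvg_sqint_add mffn mfp mfphi le f0 h0.
apply/cvg_hnormP.
have h1 : (fun n => hnorm (u_ n - u) + n.+1%:R^-1) @ \oo --> (0 : R).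
  rewrite -[X in _ --> X](addr0 0); apply: cvgD; last exact: cvg_harmonic.
  by move/cvg_hnormP : uu.
apply: (squeeze_cvgr _ (cvg_cst 0) h1); apply: nearW => n.
rewrite hnorm_ge0/= -(subrKA (u_ n)) addrC (le_trans (ler_hnormD _ _))//.
by rewrite lerD2l (phiP n).2.
Qed.

Lemma sfun_bound phi : exists2 C : R, 0 < C & forall t, `|phi t| <= C.
Proof.
have [C [_ hC]] := simple_bounded phi.
exists (Num.max C 0 + 1); first by rewrite ltr_wpDl// le_max lexx orbT.
by move=> t; apply: hC => //; rewrite ltr_pwDr// le_max lexx.
Qed.

(** A simple function is bounded by some C, so multiplication by [phi] and the operator [S phi] are
    both continuous with constant C; they preserve the two convergences that define the integral of
    f. *)
Lemma is_spectral_integral_simpleM f phi x v : is_spectral_integral E f x v ->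
  is_spectral_integral E (fun t => phi t * f t) x (S phi v).
Proof.
move=> [mf [psi [fpsi psiv]]]; have [C C0 phiC] := sfun_bound phi.
have C0' : 0 <= C by exact: ltW.
split; first by apply: measurable_funM => //; exact: measurable_funPT.
exists (fun n => phi * psi n); split.
  have h : (fun n => (C ^+ 2)%:E * sqint x (fun t => f t - psi n t))%E @ \oo --> 0%E.
    by rewrite -[X in _ --> X](mule0 (C ^+ 2)%:E); exact: cvgeZl.
  apply: (squeeze_cvge _ (cvg_cst 0%E) h); apply: nearW => n.
  have mB : measurable_fun setT (fun t => f t - psi n t).
    by apply: measurable_funB => //; exact: measurable_funPT.
  have mP : measurable_fun setT (fun t => phi t * f t - (phi * psi n) t).
    apply: measurable_funB; last exact: measurable_funPT.
    by apply: measurable_funM => //; exact: measurable_funPT.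
  apply/andP; split; first exact: (sqint_ge0 (spectral_measure hE x)).
  rewrite -(sqintZ (spectral_measure hE x) C mB).
  apply: (sqint_le (spectral_measure hE x) mP (measurable_funM _ mB)) => // t.
  rewrite -[(phi * psi n) t]/(phi t * psi n t) -mulrBr !normrM.
  by rewrite ler_wpM2r// (le_trans (phiC t))// ler_norm.
under eq_fun do rewrite (simple_spectral_integralM hE).
apply/cvg_hnormP.
have h1 : (fun n => C * hnorm (S (psi n) x - v)) @ \oo --> (0 : R).
  rewrite -[X in _ --> X](mulr0 C); apply: cvgM; first exact: cvg_cst.
  by move/cvg_hnormP : psiv.
apply: (squeeze_cvgr _ (cvg_cst 0) h1); apply: nearW => n.
rewrite hnorm_ge0/=.
set a := S (psi n) x.
have -> : S phi a - S phi v = S phi (a - v).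
  rewrite !simple_spectral_integralE -sumrB; apply: eq_bigr => c _.
  by rewrite -scalerBr (pvmB hE)//; exact: sfun_preimage_measurable.
(* The operator bound |S phi w| <= C |w| at w = a - v: by the isometry at w, it compares the
   integrals of phi^2 and C^2 against the mass of w. *)
apply: hnorm_sqr_le; first by rewrite mulr_ge0// hnorm_ge0.
rewrite exprMn -lee_fin (hnorm_simple_spectral_integral hE) EFinM.
have -> : (hnorm (a - v) ^+ 2)%:E = sqint (a - v) (cst (1 : R)).
  by rewrite (hnorm_is_spectral_integral (cst_is_spectral_integral 1 _)) of_real1 scale1r.
have m1 : measurable_fun setT (cst 1 : R -> R) by exact: measurable_cst.
have mphi : measurable_fun setT phi by exact: measurable_funPT.
rewrite -(sqintZ (spectral_measure hE (a - v)) C m1).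
have mC : measurable_fun setT (fun t : R => C * cst 1 t) by exact: measurable_funM.
apply: (sqint_le (spectral_measure hE (a - v)) mphi mC) => t.
by rewrite mulr1 (le_trans (phiC t))// ler_norm.
Qed.

(** For simple [phi] both sides are the squared norm of [S phi v], by the isometry at v and at x.
    Simple functions increasing to |g| then give every measurable g by monotone convergence,
    infinite values included. *)
Lemma sqint_change f g x v : is_spectral_integral E f x v ->
  measurable_fun setT g -> sqint v g = sqint x (fun t => g t * f t).
Proof.
move=> fv mg.
have mng : measurable_fun setT (fun t => `|g t|) by exact: measurableT_comp.
have [phi [phi1 phi2 phi3]] := nonneg_sfun_approx mng (fun t => normr_ge0 (g t)).
have eqn n : sqint v (phi n) = sqint x (fun t => phi n t * f t).
  rewrite (hnorm_is_spectral_integral (is_spectral_integral_simpleM (phi n) fv)).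
  by rewrite -(hnorm_is_spectral_integral (simple_is_spectral_integral _ _)).
have mono (mu : {measure set R -> \bar R}) (h : R -> R) : measurable_fun setT h ->
    (fun n => \int[mu]_t ((phi n t * h t) ^+ 2)%:E)%E @ \oo -->
    (\int[mu]_t ((g t * h t) ^+ 2)%:E)%E.
  move=> mh; have mph n : measurable_fun setT (fun t => phi n t * h t).
    by apply: measurable_funM => //; exact: measurable_funPT.
  have h2 (n : nat) (t : R) : setT t -> (0 <= ((phi n t * h t) ^+ 2)%:E)%E.
    by rewrite lee_fin sqr_ge0.
  have h3 (t : R) : setT t ->
      {homo (fun n => ((phi n t * h t) ^+ 2)%:E) : n m / (n <= m)%N >-> (n <= m)%E}.
    move=> _ m n mn; rewrite lee_fin !exprMn ler_wpM2r ?sqr_ge0//.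
    have /andP[m0 _] := phi1 m t; have /andP[n0 _] := phi1 n t.
    by rewrite ler_sqr ?nnegrE//; exact: phi2.
  have := @cvg_monotone_convergence _ _ _ mu setT measurableT
    (fun n t => ((phi n t * h t) ^+ 2)%:E) (fun n => measurable_sqr (mph n)) h2 h3.
  rewrite (_ : (\int[mu]_(t in _) _) = \int[mu]_t ((g t * h t) ^+ 2)%:E)%E//.
  apply: eq_integral => t _; apply/cvg_lim => //; apply: cvg_EFin; first exact: nearW.
  rewrite exprMn -real_normK ?num_real// -exprMn.
  have h' : (fun n => phi n t * h t) @ \oo --> `|g t| * h t.
    by apply: cvgM; [exact: phi3|exact: cvg_cst].
  exact: (cvgM h' h').
have mv := mono (spectral_measure hE v) (cst 1) (@measurable_cst _ _ _ _ _ _).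
have mx := mono (spectral_measure hE x) f fv.1.
have e1 : sqint v g = (\int[spectral_measure hE v]_t ((g t * cst 1 t) ^+ 2)%:E)%E.
  by apply: eq_integral => t _; rewrite mulr1.
rewrite e1; apply: (cvg_unique _ mv) => //.
rewrite (_ : (fun n => _) = (fun n => sqint x (fun t => phi n t * f t)))//.
apply/funext => n; rewrite -eqn.
by apply: eq_integral => t _; rewrite mulr1.
Qed.

(** If phi_n approximates g for the mass of v, then phi_n f approximates g f for the mass of x,
    since [sqint_change] makes the two distances equal. Closedness of the integral concludes. *)
Lemma is_spectral_integral_comp f g x u v :
  is_spectral_integral E f x v -> is_spectral_integral E g v u ->
  is_spectral_integral E (fun t => g t * f t) x u.
Proof.
move=> fv [mg [phi [gphi phiu]]].
apply: (@is_spectral_integral_closed _ (fun n t => phi n t * f t) _ _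
  (fun n => S (phi n) v)) => //.
- by apply: measurable_funM => //; exact: fv.1.
- by move=> n; exact: is_spectral_integral_simpleM.
have mgp n : measurable_fun setT (fun t => g t - phi n t).
  by apply: measurable_funB => //; exact: measurable_funPT.
rewrite (_ : (fun n => _) = (fun n => sqint v (fun t => g t - phi n t))).
  exact: gphi.
apply/funext => n; rewrite (sqint_change fv (mgp n)).
by apply: eq_integral => t _; rewrite mulrBl.
Qed.

End spectral_integral.

(** * Riesz representation and the spectrum of T^*T *)

Section riesz.
Context {R : realType} {k : scalar_kind} {H : hilbertType R k}.

(* The representing vector minimises [|u|^2 - 2 Re (l u)]. *)
Lemma riesz_representation (l : H -> scalars R k) (M : R) :
  (forall a u v, l (a *: u + v) = a * l u + l v) ->
  (forall u, `|scalar_re (l u)| <= M * hnorm u) ->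
  exists v, forall u, l u = inner u v.
Proof.
move=> llin lM.
have l0 : l 0 = 0.
  by have := llin (-1) 0 0; rewrite scaler0 addr0 mulN1r addNr.
have lD u v : l (u + v) = l u + l v by rewrite -{1}(scale1r u) llin mul1r.
have lZ a u : l (a *: u) = a * l u by rewrite -(addr0 (a *: u)) llin l0 addr0.
pose L u := scalar_re (l u).
have LD u v : L (u + v) = L u + L v by rewrite /L lD scalar_reD.
have LZ r u : L (of_real k r *: u) = r * L u by rewrite /L lZ scalar_reZ.
pose Q u := hnorm u ^+ 2 - 2 * L u.
(* Completing the square: Q u is at least (|u| - M)^2 - M^2. *)
have Qlb u : - M ^+ 2 <= Q u.
  have := lM u; rewrite -/(L u) => /(le_trans (ler_norm _)) h; rewrite /Q.
  by have := sqr_ge0 (hnorm u - M); rewrite sqrrB mulr2n; nra.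
have infQ : has_inf (range Q).
  split; first by exists (Q 0); exists 0.
  by exists (- M ^+ 2) => _ [u _ <-].
pose m := inf (range Q).
have mQ u : m <= Q u by apply: (ge_inf infQ.2); exists u.
(* The parallelogram law, with the midpoint of u and v as a competitor for the infimum; it makes
   every minimising sequence Cauchy. *)
have dist u v : hnorm (u - v) ^+ 2 <= 2 * (Q u - m) + 2 * (Q v - m).
  have := mQ (of_real k 2^-1 *: (u + v)).
  rewrite /Q hnormZ LZ exprMn real_normK ?num_real// LD.
  have := parallelogram u v; lra.
have /choice[u_ uP] n : exists u, Q u < m + n.+1%:R^-1.
  have n0 : (0 : R) < n.+1%:R^-1 by rewrite invr_gt0.
  by have [_ [u _ <-]] := inf_adherent n0 infQ => ?; exists u.
have [v uv] : exists v : H, u_ @ \oo --> v.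
  apply: hilbert_cauchy => e e0.
  have e4 : 0 < e ^+ 2 / 4 by rewrite divr_gt0// exprn_gt0.
  have [N _ hN] : \forall n \near \oo, n.+1%:R^-1 < e ^+ 2 / 4.
    have /cvgrPdist_lt/(_ _ e4) := @cvg_harmonic R.
    by apply: filterS => n; rewrite sub0r normrN ger0_norm// harmonic_ge0.
  have {}hN n : (N <= n)%N -> n.+1%:R^-1 < e ^+ 2 / 4 by exact: hN.
  exists N => p q /hN hp /hN hq.
  rewrite -ltr_sqr ?nnegrE ?hnorm_ge0 ?(ltW e0)// (le_lt_trans (dist _ _))//.
  have h n : n.+1%:R^-1 < e ^+ 2 / 4 -> Q (u_ n) - m < e ^+ 2 / 4.
    by move=> hn; rewrite ltrBlDl (lt_trans (uP n))// ltrD2l.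
  by have := h _ hp; have := h _ hq; lra.
have Qv : Q v <= m.
  have Lv : (fun n => L (u_ n)) @ \oo --> L v.
    apply/cvgrPdist_le => e e0; move/cvg_hnormP/cvgrPdist_lt : uv.
    have M1 : 0 < `|M| + 1 by rewrite ltr_wpDl.
    move=> /(_ (e / (`|M| + 1))); rewrite divr_gt0// => /(_ isT).
    apply: filterS => n; rewrite sub0r normrN ger0_norm ?hnorm_ge0// ltr_pdivlMr// => h.
    have -> : L v - L (u_ n) = L (v - u_ n).
      rewrite LD -[in RHS]scaleN1r -of_real1 -[- of_real k 1]add0r.
      by rewrite -of_real0 -of_realB LZ sub0r mulN1r.
    rewrite (le_trans (lM _))// (le_trans _ (ltW h))// hnormBC mulrC.
    rewrite ler_wpM2l ?hnorm_ge0//.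
    by rewrite (le_trans (ler_norm _))// lerDl.
  have cQ : (fun n => Q (u_ n)) @ \oo --> Q v.
    have h : (fun n => hnorm (u_ n)) @ \oo --> hnorm v by exact: cvg_hnorm.
    have h1 : (fun n => hnorm (u_ n) ^+ 2) @ \oo --> hnorm v ^+ 2 by exact: (cvgM h h).
    have h2 : (fun n => 2 * L (u_ n)) @ \oo --> 2 * L v.
      by apply: cvgM => //; exact: cvg_cst.
    exact: (cvgB h1 h2).
  have cm : (fun n => m + n.+1%:R^-1) @ \oo --> m.
    by rewrite -[X in _ --> X]addr0; apply: cvgD; [exact: cvg_cst|exact: cvg_harmonic].
  rewrite -(cvg_lim _ cQ)// -(cvg_lim _ cm)//.
  apply: ler_lim; [exact: cvgP cQ|exact: cvgP cm|].
  by apply: nearW => n; exact: ltW.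
have re_eq h : L h = rinner h v.
  (* Minimality of v along the line v + t h; the linear coefficient in t must vanish. *)
  have ineq t : 0 <= t * (2 * (rinner h v - L h)) + t ^+ 2 * hnorm h ^+ 2.
    have := le_trans Qv (mQ (v + of_real k t *: h)); rewrite /Q.
    rewrite hnormD_sqr hnormZ LD LZ exprMn real_normK ?num_real// rinnerZr rinnerC.
    by lra.
  have c0 := sqr_ge0 (hnorm h).
  move: ineq; set c := hnorm h ^+ 2 in c0 *; set d := rinner h v - L h => ineq.
  suff : d = 0 by rewrite /d; lra.
  (* This t nearly minimises the quadratic and gives a negative multiple of d^2; c + 1 in place of c
     keeps the division valid when h = 0. *)
  have := ineq (- d / (c + 1)).
  rewrite (_ : _ + _ = - (d ^+ 2 * ((c + 2) / (c + 1) ^+ 2))); last first.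
    by field; rewrite gt_eqF// ltr_wpDl.
  rewrite oppr_ge0 pmulr_lle0; last by rewrite divr_gt0 ?exprn_gt0//; lra.
  by move=> d2; apply/eqP; rewrite -sqrf_eq0 eq_le d2 sqr_ge0.
(* So far only real parts agree. Testing with a u, where a is the conjugate of l u - <u, v>, turns
   the real part of the difference into |l u - <u, v>|^2. *)
exists v => u; apply/eqP; rewrite -subr_eq0; apply/eqP/scalar_mul_conj_eq0.
set a := scalar_conj _.
have := re_eq (a *: u); rewrite /L lZ /rinner innerZl.
have -> : (l u - inner u v) * a = a * l u + of_real k (-1) * (a * inner u v).
  rewrite -[in of_real k _](sub0r 1) of_realB of_real0 of_real1.
  by rewrite sub0r mulN1r -mulrBr mulrC.
by rewrite scalar_reD scalar_reZ => ->; rewrite mulN1r subrr.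
Qed.

End riesz.

(** * The adjoint and the positivity of T^*T *)

Section adjoint.
Context {R : realType} {k : scalar_kind} {X Y : hilbertType R k}.
Variables (T : {linear X -> Y}) (Tb : bounded_operator T).

Lemma adjointP y u : inner (T u) y = inner u (adjoint T y).
Proof.
suff [v Tv] : exists v, forall u, inner (T u) y = inner u v.
  by have := @getPex _ [set x | forall u, inner (T u) y = inner u x]
    (ex_intro _ v Tv); exact.
have [M TM] := Tb.
apply: (@riesz_representation _ _ _ (fun u => inner (T u) y) (M * hnorm y)).
  move=> a w z; have -> : T (a *: w + z) = a *: T w + T z by rewrite linearP.
  by rewrite linearDl /= innerZl.
move=> w; rewrite (le_trans (rinner_le _ _))// mulrAC ler_wpM2r ?hnorm_ge0//.
Qed.

Variables (E : set R -> X -> X) (hE : spectral_measure_of (adjoint T \o T) E).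
Hypothesis Tinj : injective T.

(* On the range of [E N] the operator [T^*T] is both nonnegative and
   nonpositive. *)
Lemma spectral_projection_nonpos (N : set R) (mN : measurable N) x :
  (forall t, N t -> t <= 0) -> E N x = 0.
Proof.
move=> N0; have [pE IA] := hE; set z := E N x.
have Nz : is_spectral_integral E (indic_sfun N mN) z z.
  have := simple_is_spectral_integral pE (indic_sfun N mN) z.
  by rewrite (simple_spectral_integral_indic pE) {3}/z (pvm_idem pE).
set Az := adjoint T (T z).
have NA := is_spectral_integral_comp pE Nz (IA z).
have Nm := is_spectral_integral_comp pE Nz (cst_is_spectral_integral pE (-1) z).
have e1 := is_spectral_integral_isometry pE NA Nz.
have e2 := is_spectral_integral_isometry pE NA Nm.
(* For t <= 0 one has |t + 1| <= |t - 1|. Integrated over N this reads |Az + z| <= |Az - z|, that is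
   Re <Az, z> <= 0, whereas Re <Az, z> = |Tz|^2. *)
have Nle (t : R) : `|id t * indic_sfun N mN t - cst (-1) t * indic_sfun N mN t| <=
    `|id t * indic_sfun N mN t - indic_sfun N mN t|.
  rewrite /= mulN1r opprK /mindic indicE; case: (boolP (t \in N)) => /=.
    rewrite inE => /N0 t0; rewrite mulr1.
    rewrite (ler0_norm (_ : t - 1 <= 0)); last by lra.
    by rewrite ler_norml; lra.
  by rewrite mulr0 subr0 addr0.
have m1 : measurable_fun setT (fun t : R =>
    id t * indic_sfun N mN t - cst (-1) t * indic_sfun N mN t).
  by apply: measurable_funB; [exact: NA.1|exact: Nm.1].
have m2 : measurable_fun setT (fun t : R => id t * indic_sfun N mN t - indic_sfun N mN t).
  by apply: measurable_funB; [exact: NA.1|exact: Nz.1].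
have := sqint_le (spectral_measure pE z) m1 m2 Nle.
have re : rinner Az z = hnorm (T z) ^+ 2.
  by rewrite rinnerC /rinner -adjointP -/(rinner _ _) rinnerxx.
have oN : of_real k (-1 : R) *: z = - z.
  by rewrite -sub0r of_realB of_real0 of_real1 sub0r scaleN1r.
rewrite e1 e2 lee_fin oN opprK hnormD_sqr hnormB_sqr re => le.
have Tz0 : hnorm (T z) = 0.
  by apply/eqP; rewrite -sqrf_eq0 eq_le sqr_ge0 andbT; lra.
by apply: Tinj; rewrite linear0; apply: hnorm0_eq0.
Qed.

(** Composing with this integral cuts any integrand off to the open half-line, where 1/s is defined.
    The point 0 carries no mass because T is injective. *)
Lemma spectral_integral_pos x :
  is_spectral_integral E (\1_(`]0, +oo[ : set R)) x x.
Proof.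
have [pE _] := hE; have mP : measurable (`]0, +oo[ : set R) by exact: measurable_itv.
have := simple_is_spectral_integral pE (indic_sfun _ mP) x.
rewrite (simple_spectral_integral_indic pE) (_ : E _ x = x)//.
have mN := measurableC mP.
have N0 : E (~` `]0, +oo[%classic) x = 0.
  apply: spectral_projection_nonpos => // t /=.
  by rewrite in_itv /= andbT => /negP; rewrite -leNgt.
by rewrite -[RHS](pvmT pE) -(setUv `]0, +oo[%classic) (pvmU pE) ?setICr// N0 addr0.
Qed.

End adjoint.

(** * Measurability *)

Section measurability.
Context {R : realType}.

Lemma countable_measurable_fun (D : set R) (f : R -> R) : countable D ->
  measurable_fun D f.
Proof.
move=> cD _ B mB; apply: countable_measurable => //; apply: (sub_countable _ cD).
by apply: subset_card_le => t [].
Qed.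

Lemma piecewise_continuous_measurable (f : R -> R) : piecewise_continuous f ->
  measurable_fun setT (f \_ `[0, +oo[).
Proof.
move=> [fin _ _].
pose D := \bigcup_(n : nat) [set l : R | 0 < l <= n%:R /\ ~ {for l, continuous f}].
have cD : countable D by apply: bigcup_countable => // n _; exact: finite_set_countable.
have mD : measurable D by apply: countable_measurable.
have mI : measurable (`]0, +oo[ : set R) by exact: measurable_itv.
apply/measurable_restrict => //; rewrite setTI.
(* The discontinuities form a countable set, on which every function is measurable. The endpoint 0
   is put with them, since f need not be continuous there. *)
rewrite (_ : `[0, +oo[%classic = (`]0, +oo[ `\` D) `|` (D `|` [set 0])).
  apply/measurable_funU; [exact: measurableD|exact: measurableU|split].
    apply: subspace_continuous_measurable_fun; first exact: measurableD.
    apply: continuous_in_subspaceT => l; rewrite inE => -[/= + Dl].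
    rewrite in_itv /= andbT => l0; apply: contrapT => lc; apply: Dl.
    exists (Num.truncn l).+1 => //=; split=> //.
    by rewrite l0/= ltW// truncnS_gt.
  by apply/measurable_funU => //; split; apply: countable_measurable_fun.
apply/seteqP; split => t /=; rewrite !in_itv /= !andbT.
  rewrite le_eqVlt => /orP[/eqP <-|t0]; first by right; right.
  by have [Dt|Dt] := pselect (D t); [right; left|left].
by move=> [[t0 _]|[[n _ /= [/andP[t0 _] _]]|->]]//; exact: ltW.
Qed.

Lemma source_function_measurable (s : R -> R) : source_function s ->
  measurable_fun setT (s \_ `[0, +oo[).
Proof.
move=> [cs _ _]; apply/measurable_restrict => //; rewrite setTI.
exact: subspace_continuous_measurable_fun.
Qed.

Lemma source_function_inv_measurable (s : R -> R) : source_function s ->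
  measurable_fun setT ((fun t => (s t)^-1) \_ `]0, +oo[).
Proof.
move=> [/continuous_within_itvcyP[cs _] _ s0].
apply/measurable_restrict => //; rewrite setTI.
apply: open_continuous_measurable_fun; first exact: interval_open.
move=> t; rewrite inE /= => t0; apply: cvgV.
  by rewrite gt_eqF// s0//; move: t0; rewrite in_itv /= andbT.
exact: cs.
Qed.

End measurability.

(** * The error of the regularization method *)

Section order_source.
Context {R : realType} {k : scalar_kind} {X Y : hilbertType R k}.

(** The kernel is trivial, so every vector is orthogonal to it and the preimage of the component of
    y in R(T) qualifies for the choice in [mp_inverse]. *)
Lemma mp_inverseP (T : {linear X -> Y}) (y : Y) : injective T -> mp_domain T y ->
  exists2 w, orth (range T) w & y = T (mp_inverse T y) + w.
Proof.
move=> Tinj [_ [w [[x _ <-] Tw ->]]].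
have /getPex[] // : exists x', [set x' : X | orth [set u | T u = 0] x' /\
    exists2 w', orth (range T) w' & T x + w = T x' + w'] x'.
exists x; split; last by exists w.
move=> u /= Tu0; have -> : u = 0 by apply: Tinj; rewrite linear0.
by rewrite linear0l.
Qed.

(** The normal equation. As w is orthogonal to R(T), the two adjoints are chosen by [get] from the
    same set. *)
Lemma adjoint_mp_domain (T : {linear X -> Y}) (y w : Y) (x : X) :
  orth (range T) w -> y = T x + w -> adjoint T y = adjoint T (T x).
Proof.
move=> Tw ->; rewrite /adjoint; congr (get _); apply/seteqP; split=> v /= Tv u.
  by rewrite -Tv linearDr /= (Tw (T u))// addr0.
by rewrite linearDr /= (Tw (T u))// addr0 Tv.
Qed.

Variables (T : {linear X -> Y}) (E : set R -> X -> X).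
Hypotheses (Tb : bounded_operator T) (Tinj : injective T).
Hypothesis hE : spectral_measure_of (adjoint T \o T) E.

Let pE : projection_valued_measure E := hE.1.
Local Notation pos := (`]0, +oo[%classic : set R).

(** The bound |t g_a(t)| <= C makes the product integrand square-integrable, so T^*T x lies in the
    domain of g_a(T^*T) and [get] returns a genuine value. *)
Lemma regularization_integral (a0 : \bar R) (g : R -> R -> R) (a : R) (x : X) :
  spectral_regularization a0 g -> 0 < a -> (a%:E < a0)%E ->
  is_spectral_integral E (fun t => (g a \_ `[0, +oo[) t * (t * \1_pos t)) x
    (function_of_operator E (g a) (adjoint T (T x))).
Proof.
move=> [pg [C C0 gC] _] a_gt0 a_lt.
have xpos := spectral_integral_pos Tb hE Tinj x.
have xA := is_spectral_integral_comp pE xpos (hE.2 x).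
have mg := piecewise_continuous_measurable (pg _ a_gt0 a_lt).
set G := g a \_ _ in mg *.
apply: (is_spectral_integral_comp pE xA).
suff /getPex : exists u, is_function_of_operator E (g a) (adjoint T (T x)) u by [].
have [|u Gu] := @is_spectral_integral_exists _ _ _ _ pE G (adjoint T (T x)) mg;
  last by exists u.
rewrite (sqint_change pE xA mg).
have mC : measurable_fun setT (cst C : R -> R) by exact: measurable_cst.
have mGA : measurable_fun setT (fun t => G t * (id t * \1_pos t)).
  by apply: measurable_funM => //; exact: xA.1.
apply: (@le_lt_trans _ _ (\int[spectral_measure pE x]_t ((cst C t ^+ 2)%:E))%E).
  apply: (sqint_le (spectral_measure pE x) mGA mC) => t.
  rewrite [X in _ <= X]gtr0_norm// indicE; case: (boolP (t \in pos)) => [|_].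
    rewrite inE /= in_itv /= andbT => t0; rewrite mulr1 /G patchE mem_set.
      by rewrite mulrC; apply: gC => //; exact: ltW.
    by rewrite /= in_itv /= andbT ltW.
  by rewrite !mulr0 normr0 ltW.
by rewrite (hnorm_is_spectral_integral pE (cst_is_spectral_integral pE C x)) ltry.
Qed.

(** The error is the integral of t g_a(t) - 1 = -r_a(t) over t > 0, and the hypothesis says 1/s <=
    |r_a| / c on [h, +oo[. The isometry turns this pointwise bound into the stated one. *)
Lemma regularization_error_ge (a0 : \bar R) (g : R -> R -> R) (s : R -> R)
  (a h c : R) (x : X) :
  spectral_regularization a0 g -> source_function s ->
  0 < a -> (a%:E < a0)%E -> 0 < h -> 0 < c ->
  (forall l, h <= l -> c <= s l * `|residual g a l|) ->
  (\int[spectral_measure pE x]_t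
     ((((fun l => (s l)^-1) \_ `[h, +oo[) t ^+ 2)%:E) <=
   ((hnorm (function_of_operator E (g a) (adjoint T (T x)) - x) / c) ^+ 2)%:E)%E.
Proof.
move=> hg hs a_gt0 a_lt h0 c0 hc.
have xpos := spectral_integral_pos Tb hE Tinj x.
have gx := regularization_integral x hg a_gt0 a_lt.
have iso := is_spectral_integral_isometry pE gx xpos.
set u := function_of_operator _ _ _ in gx iso *.
have mh : measurable_fun setT ((fun l => (s l)^-1) \_ `[h, +oo[).
  rewrite (_ : _ \_ _ = fun t =>
      ((fun l => (s l)^-1) \_ `]0, +oo[) t * \1_(`[h, +oo[%classic : set R) t).
    apply: measurable_funM; first exact: source_function_inv_measurable.
    by apply: measurable_indic; exact: measurable_itv.
  apply/funext => t; rewrite !patchE indicE !mem_setE !in_itv /= !andbT.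
  by case: (leP h t) => [ht|_]; rewrite ?mulr0// mulr1 (lt_le_trans h0 ht).
have mr : measurable_fun setT (fun t => (g a \_ `[0, +oo[) t * (t * \1_pos t) - \1_pos t).
  by apply: measurable_funB; [exact: gx.1|exact: xpos.1].
rewrite expr_div_n mulrC EFinM -iso -exprVn -sqintZ//.
apply: sqint_le => //; first exact: measurable_funM.
move=> t; rewrite !patchE indicE !mem_setE !in_itv /= !andbT.
case: (leP h t) => [ht|_]; last by rewrite normr0.
have t0 := lt_le_trans h0 ht; rewrite t0 (ltW t0) !mulr1.
have st : 0 < s t by case: hs => _ _; exact.
rewrite normrM !normfV (gtr0_norm c0) (gtr0_norm st).
have -> : `|g a t * t - 1| = `|residual g a t| by rewrite distrC mulrC.
by rewrite ler_pdivlMl// ler_pdivrMr// mulrC hc.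
Qed.

End order_source.

(** * From tail bounds on 1/s to the source condition *)

Section converse.
Context {R : realType} {k : scalar_kind} {X Y : hilbertType R k}.
Variables (T : {linear X -> Y}) (E : set R -> X -> X).
Hypotheses (Tb : bounded_operator T) (Tinj : injective T).
Hypothesis hE : spectral_measure_of (adjoint T \o T) E.

Let pE : projection_valued_measure E := hE.1.
Local Notation inv s := ((fun l : R => (s l)^-1) \_ `]0, +oo[).

(** On ]0, +oo[ the functions s and 1/s multiply to 1, so applying them successively to x amounts to
    integrating the indicator of that half-line, which returns x. *)
Lemma range_function_of_operatorP (s : R -> R) (x : X) : source_function s ->
  (\int[spectral_measure pE x]_t (((inv s) t ^+ 2)%:E) < +oo)%E ->
  range_function_of_operator E s x.
Proof.
move=> hs sx.
have xpos := spectral_integral_pos Tb hE Tinj x.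
have ms := source_function_measurable hs.
have mi := source_function_inv_measurable hs.
have [x' xx'] := is_spectral_integral_exists mi sx.
have sE t : (s \_ `[0, +oo[) t * (inv s) t = \1_(`]0, +oo[%classic : set R) t.
  rewrite !patchE indicE !mem_setE !in_itv /= !andbT.
  case: (ltP 0 t) => [t0|_]; last by rewrite mulr0.
  by rewrite (ltW t0) divff// gt_eqF//; case: hs => _ _; exact.
(* The vector x' is in the domain of s(T^*T): integrating s^2 against its mass is integrating an
   indicator against the mass of x. *)
have [|u su] := @is_spectral_integral_exists _ _ _ _ pE _ x' ms.
  rewrite (sqint_change pE xx' ms).
  under eq_integral do rewrite sE.
  by rewrite (hnorm_is_spectral_integral pE xpos) ltry.
have := is_spectral_integral_comp pE xx' su; rewrite (funext sE) => xu.
by exists x'; rewrite (is_spectral_integral_unique pE xpos xu).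
Qed.

(** Bounds are given only for some arbitrarily small h. The tail from 1 / (n + 1) is dominated by
    the tail from some smaller h, hence obeys the same bound, and these tails increase to the full
    integral. *)
Lemma inv_source_tail_limit (s : R -> R) (x : X) (C : R) : source_function s ->
  (forall e, 0 < e -> exists2 h, 0 < h <= e &
    (\int[spectral_measure pE x]_t
      (((fun l => (s l)^-1) \_ `[h, +oo[) t ^+ 2)%:E <= C%:E)%E) ->
  (\int[spectral_measure pE x]_t (((inv s) t ^+ 2)%:E) <= C%:E)%E.
Proof.
move=> hs tail; have mi := source_function_inv_measurable hs.
pose tl h := (fun l : R => (s l)^-1) \_ `[h, +oo[.
have tlE h t : 0 < h -> tl h t = (inv s) t * \1_(`[h, +oo[%classic : set R) t.
  move=> h0; rewrite /tl !patchE indicE !mem_setE !in_itv /= !andbT.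
  by case: (leP h t) => [ht|_]; rewrite ?mulr0// mulr1 (lt_le_trans h0 ht).
have mtl h : 0 < h -> measurable_fun setT (tl h).
  move=> h0; rewrite (funext (fun t => tlE h t h0)).
  apply: measurable_funM; first exact: mi.
  by apply: measurable_indic; exact: measurable_itv.
have tl_le h h' t : h' <= h -> `|tl h t| <= `|tl h' t|.
  move=> hh; rewrite /tl !patchE !mem_setE !in_itv /= !andbT.
  case: (leP h t) => [ht|_]; last by rewrite normr0.
  by rewrite (le_trans hh ht).
pose e n : R := n.+1%:R^-1.
have e0 n : 0 < e n by rewrite invr_gt0.
have ge0 (n : nat) (t : R) : setT t -> (0 <= (tl (e n) t ^+ 2)%:E)%E.
  by rewrite lee_fin sqr_ge0.
have mono (t : R) : setT t ->
    {homo (fun n => (tl (e n) t ^+ 2)%:E) : n m / (n <= m)%N >-> (n <= m)%E}.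
  move=> _ n m nm; rewrite lee_fin -real_normK ?num_real// -[leRHS]real_normK ?num_real//.
  by rewrite ler_sqr ?nnegrE//; apply: tl_le; rewrite lef_pV2 ?posrE// ler_nat ltnS.
have := @cvg_monotone_convergence _ _ _ (spectral_measure pE x) setT measurableT
  (fun n t => (tl (e n) t ^+ 2)%:E) (fun n => measurable_sqr (mtl _ (e0 n))) ge0 mono.
rewrite (_ : (\int[_]_(t in _) _) =
  \int[spectral_measure pE x]_t (((inv s) t ^+ 2)%:E))%E => [cv|].
  apply: (cvge_to_le cv); apply: nearW => n.
  have [h /andP[h0 hn] /(le_trans _)] := tail _ (e0 n); apply.
  apply: (sqint_le (spectral_measure pE x) (mtl _ (e0 n)) (mtl _ h0)) => t.
  exact: tl_le.
apply: eq_integral => t _; apply/cvg_lim => //.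
(* At each t the sequence is eventually constant: it is always 0 for t <= 0, and equals its limit
   once 1 / (n + 1) <= t for t > 0. *)
apply: cvg_near_cst; have [t0|t0] := ltP 0 t; last first.
  apply: nearW => n; rewrite tlE//; congr ((_ ^+ 2)%:E).
  by rewrite patchE mem_setE in_itv /= andbT ltNge t0 mul0r.
have /cvgrPdist_lt/(_ _ t0) := @cvg_harmonic R; apply: filterS => n.
rewrite sub0r normrN ger0_norm ?harmonic_ge0// => /ltW nt.
by rewrite tlE// indicE mem_setE in_itv /= nt mulr1.
Qed.

End converse.

Theorem theorem4p2 (R : realType) (k : scalar_kind) (X Y : hilbertType R k)
    (T : {linear X -> Y}) (E : set R -> X -> X)
    (a0 : \bar R) (g : R -> R -> R) (rho s : R -> R) (y : Y) :
  infinite_dimensional X ->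
  infinite_dimensional Y ->
  bounded_operator T ->
  injective T ->
  ~ closed (range T) ->
  spectral_measure_of (adjoint T \o T) E ->
  (0 < a0)%E ->
  spectral_regularization a0 g ->
  order_function rho ->
  source_function s ->
  mp_domain T y ->
  order_source_pair a0 g rho s ->
  (fun a : R =>
     hnorm (function_of_operator E (g a) (adjoint T y) - mp_inverse T y) : R^o)
    =O_ (0^'+) (rho : R -> R^o) ->
  range_function_of_operator E s (mp_inverse T y).
Proof.
move=> _ _ Tb Tinj _ hE a0_gt0 hg [rho_gt0 _ _] hs yT.
move=> [gamma [h [gamma0 h_gt0 h0 hgamma]]].
have [w Tw yE] := mp_inverseP Tinj yT.
rewrite (adjoint_mp_domain Tw yE); move: (mp_inverse T y) => x.
move=> /eqO_exP[K K0 bigO].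
have := @range_function_of_operatorP _ _ _ _ T E Tb Tinj hE s x hs.
apply.
(* The error is at most K rho(a) and the order-source constant is c = gamma rho(a); rho(a) cancels
   in the quotient, so the bound is uniform in a. *)
apply: (@le_lt_trans _ _ ((K / gamma) ^+ 2)%:E); last exact: ltry.
apply: inv_source_tail_limit => // e e0.
have a_lt : \forall a \near 0^'+, (a%:E < a0)%E.
  case: a0 a0_gt0 {hg h_gt0 hgamma} => [r|_|//].
    by rewrite lte_fin => r0; apply: filterS (nbhs_right_lt r0) => a; rewrite lte_fin.
  by apply: nearW => a; rewrite ltry.
have h_lt : \forall a \near 0^'+, h a <= e.
  move/cvgrPdist_lt : h0 => /(_ _ e0); apply: filterS => a; rewrite sub0r normrN => ha.
  exact: le_trans (ler_norm _) (ltW ha).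
(* Near 0 some a is admissible, obeys the rate, and has h(a) <= e; the tail then starts at h(a). *)
have [a [[[a_gt0 aa0] ha] ra]] :=
  filter_ex (filterI (filterI (filterI (nbhs_right_gt 0) a_lt) h_lt) bigO).
have ha0 := h_gt0 _ a_gt0 aa0; have ra0 := rho_gt0 _ a_gt0.
exists (h a); first by rewrite ha0.
have c0 : 0 < gamma * rho a by rewrite mulr_gt0.
apply: le_trans (regularization_error_ge Tb Tinj hE x hg hs a_gt0 aa0 ha0 c0 _) _.
  by move=> l hl; rewrite -ler_pdivlMr//; exact: hgamma.
rewrite lee_fin ler_sqr ?nnegrE ?divr_ge0 ?hnorm_ge0 ?(ltW K0) ?(ltW c0) ?(ltW gamma0)//.
rewrite ler_pdivrMr// mulrA divfK ?gt_eqF//.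
by move: ra; rewrite ger0_norm ?hnorm_ge0// gtr0_norm.
Qed.
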